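(* Assume that the $(m,n)$-Padé approximant $r^P$ to $f:E\to\mathbb{C}$ is non-degenerate and that $a_{mn}\neq 0$. Let $\Theta\subset E$ be a compact set which contains the $m+n+1$ Chebyshev nodes of $K$, i.e. $\tau_0,\ldots,\tau_{m+n}\in\Theta$. For (sufficiently small) $\varepsilon>0$ let $r^\varepsilon\in\mathcal{I}_{mn}^{\varepsilon\Theta}$ be an interpolatory best approximation to $f$ on $\varepsilon K$, i.e. $$\|r^\varepsilon-f\|_{\varepsilon K}=\min_{r\in\mathcal{I}_{mn}^{\varepsilon\Theta}}\|r-f\|_{\varepsilon K}.$$ Then the following hold. (i) Let $z_0(\varepsilon),\ldots,z_{m+n}(\varepsilon)\in\varepsilon\Theta$ denote the interpolation nodes of $r^\varepsilon$ and define $\zeta_j(\varepsilon)=z_j(\varepsilon)/\varepsilon\in\Theta$ for $j=0,\ldots,m+n$. Then, up to ordering, $$\zeta_j(\varepsilon)\to\tau_j,\qquad j=0,\ldots,m+n,\quad \varepsilon\to 0.$$ (ii) The point-wise error satisfies, for $\varepsilon\to0$, $$r^\varepsilon(\varepsilon z)-f(\varepsilon z)=a_{mn}\,\varepsilon^{m+n+1}\prod_{j=0}^{m+n}(z-\tau_j)+o(\varepsilon^{m+n+1}),\qquad z\in K.$$ (iii) The uniform error satisfies, for $\varepsilon\to0$, $$\|r^\varepsilon-f\|_{\varepsilon K}=t_{m+n+1}\,|a_{mn}|\,\varepsilon^{m+n+1}+\mathcal{O}(\varepsilon^{m+n+2}).$$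
   Context: Setting. $E\subset\mathbb{C}$ is a domain (open) containing the origin, $f:E\to\mathbb{C}$ is holomorphic, $K\subset E$ is a non-empty compact set without isolated points, and $m,n\ge 0$ are fixed integers. $\varepsilon K=\{\varepsilon z: z\in K\}$, $\varepsilon\Theta=\{\varepsilon z:z\in\Theta\}$ for $\varepsilon>0$; $\varepsilon\to0$ means $\varepsilon\to0^+$ (for small $\varepsilon$ these sets lie in $E$). For a compact set $S$, $\|g\|_S=\max_{z\in S}|g(z)|$, with $\|g\|_S=\infty$ if $g$ has a pole in $S$. Rational functions. $\mathcal{R}_{mn}$ is the set of rational functions $p/q$ with $p,q$ complex polynomials of degree $\le m$ and $\le n$ respectively, $q\not\equiv0$. The defect of $r\in\mathcal{R}_{mn}$ is the maximal $d\ge0$ with $r\in\mathcal{R}_{m-d,n-d}$ (the zero polynomial is the only polynomial of negative degree, so the zero function has defect $n$); $r$ is non-degenerate if its defect is $0$. Newton–Padé approximation. For nodes $z_0,\ldots,z_{m+n}\in E$ (repetitions allowed), there exist polynomials $p,q$, $q\not\equiv0$, of degree $\le m$, $\le n$, with $p(z)-q(z)f(z)=\widetilde v(z)\prod_{j=0}^{m+n}(z-z_j)$ for some $\widetilde v$ holomorphic on $E$; the quotient $r=p/q\in\mathcal{R}_{mn}$ is unique and is called the Newton–Padé approximant (rational interpolant) to $f$ with interpolation nodes $z_0,\ldots,z_{m+n}$. The $(m,n)$-Padé approximant $r^P$ is the Newton–Padé approximant for $z_0=\cdots=z_{m+n}=0$. If $r^P$ is non-degenerate it has no pole at $0$, and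 $a_{mn}\in\mathbb{C}$ is defined by $r^P(z)-f(z)=a_{mn}z^{m+n+1}+\mathcal{O}(z^{m+n+2})$ as $z\to0$. Interpolatory set. For $\Theta'\subset E$, $\mathcal{I}_{mn}^{\Theta'}$ is the set of $r\in\mathcal{R}_{mn}$ which are the Newton–Padé approximant to $f$ for some nodes $z_0,\ldots,z_{m+n}\in\Theta'$ (counting multiplicity). In the stated setting minimizers over $\mathcal{I}_{mn}^{\varepsilon\Theta}$ exist for all sufficiently small $\varepsilon$. Chebyshev nodes. There is a unique sequence (up to ordering) $\tau_0,\ldots,\tau_{m+n}\in\mathbb{C}$ minimizing $\max_{z\in K}\prod_{j=0}^{m+n}|z-\zeta_j|$ over all $\zeta_0,\ldots,\zeta_{m+n}\in\mathbb{C}$; these are the $m+n+1$ Chebyshev nodes of $K$, and $t_{m+n+1}:=\max_{z\in K}\prod_{j=0}^{m+n}|z-\tau_j|$. *)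

(* Defs.v *)
From mathcomp Require Import all_boot all_order all_algebra.
From mathcomp Require Import generic_quotient fraction.
From mathcomp Require Import all_classical all_reals all_analysis.
From mathcomp Require Import complex.
Import Order.TTheory GRing.Theory Num.Theory.
Import numFieldNormedType.Exports.

Set Implicit Arguments.
Unset Strict Implicit.
Unset Printing Implicit Defensive.

Local Open Scope classical_set_scope.
Local Open Scope ring_scope.

(* Packing R[i] as a numClosedFieldType gives it the topology and the normed
   module structure over itself that the library attaches to such fields; the
   bare carrier R[i] has none. *)
Definition Cplx (R : realType) : numClosedFieldType := R[i].

(* [`|z|] lives in [Cplx R] itself; [cabs] is the same modulus as a real. *)
Definition toC (R : realType) (x : R) : Cplx R := real_complex R x.
Definition cabs (R : realType) (z : Cplx R) : R := ComplexField.Normc.normc z.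

Definition holomorphic_on (R : realType) (E : set (Cplx R))
    (f : Cplx R -> Cplx R) : Prop :=
  forall z, E z -> derivable f z 1.

Definition dilate (R : realType) (e : R) (S : set (Cplx R)) : set (Cplx R) :=
  [set toC e * z | z in S].

Section FractionRepr.
Local Open Scope quotient_scope.

Lemma tofrac_numden (D : idomainType) (x : {fraction D}) :
  x = FracField.tofrac (frac (repr x)).1 / FracField.tofrac (frac (repr x)).2.
Proof.
have d0 : (frac (repr x)).2 != 0 by exact: denom_ratioP.
have d1 : FracField.tofrac (frac (repr x)).2 != 0 by rewrite tofrac_eq0.
apply: (mulIf d1); rewrite divfK// -[in LHS](reprK x).
set y := repr x; rewrite reprK; clear d1.
transitivity (FracField.mul (\pi_(FracField.type D) y) (FracField.tofrac (frac y).2)).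
  by rewrite reprK.
unlock FracField.tofrac; rewrite -FracField.pi_mul; apply/eqmodP.
rewrite /= FracField.equivfE /FracField.mulf !numden_Ratio ?oner_neq0 ?mulr1//.
by rewrite mulrC.
Qed.

End FractionRepr.

Section RationalFunctions.
Variable R : realType.
Local Notation C := (Cplx R).

Definition ratfun := {fraction {poly C}}.

(* [size p] is the degree plus one. Only 0 has degree <= k when k < 0. *)
Definition deg_le (p : {poly C}) (k : int) : bool :=
  (p == 0) || ((size p)%:Z <= k + 1).

Definition in_ratR (m n : int) (r : ratfun) : Prop :=
  exists p q : {poly C},
    [/\ deg_le p m, deg_le q n, q != 0 &
      r = FracField.tofrac p / FracField.tofrac q].

Definition is_defect (m n : nat) (r : ratfun) (d : nat) : Prop :=
  in_ratR (m%:Z - d%:Z) (n%:Z - d%:Z) r /\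
  forall d' : nat, in_ratR (m%:Z - d'%:Z) (n%:Z - d'%:Z) r -> (d' <= d)%N.

Definition nondegenerate_rf (m n : nat) (r : ratfun) : Prop := is_defect m n r 0.

(* [repr r] is an arbitrary fraction representing r; it is put in lowest terms
   so that the poles of r are exactly the zeros of [rf_den r]. *)
Definition rf_num (r : ratfun) : {poly C} :=
  (frac (repr r)).1 %/ gcdp (frac (repr r)).1 (frac (repr r)).2.
Definition rf_den (r : ratfun) : {poly C} :=
  (frac (repr r)).2 %/ gcdp (frac (repr r)).1 (frac (repr r)).2.

Lemma rf_den_neq0 (r : ratfun) : rf_den r != 0.
Proof.
rewrite /rf_den dvdp_div_eq0 ?dvdp_gcdr//.
exact: denom_ratioP.
Qed.

Lemma coprimep_rf (r : ratfun) : coprimep (rf_num r) (rf_den r).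
Proof.
apply: coprimep_div_gcd; apply/orP; right.
exact: denom_ratioP.
Qed.

Lemma rf_num_den (r : ratfun) :
  r = FracField.tofrac (rf_num r) / FracField.tofrac (rf_den r).
Proof.
have d0 : (frac (repr r)).2 != 0 by exact: denom_ratioP.
have g0 : gcdp (frac (repr r)).1 (frac (repr r)).2 != 0.
  by rewrite gcdp_eq0 negb_and d0 orbT.
rewrite [LHS]tofrac_numden.
rewrite -[in LHS](divpK (dvdp_gcdl (frac (repr r)).1 (frac (repr r)).2)).
rewrite -[X in _ / FracField.tofrac X = _](divpK
  (dvdp_gcdr (frac (repr r)).1 (frac (repr r)).2)).
by rewrite !rmorphM/= -mulf_div divff ?mulr1// tofrac_eq0.
Qed.

Definition rf_pole (r : ratfun) (z : C) : bool := (rf_den r).[z] == 0.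

(* The value of r at z; meaningless at a pole. *)
Definition rf_eval (r : ratfun) (z : C) : C := (rf_num r).[z] / (rf_den r).[z].

(* The norm || r - f ||_S, infinite as soon as r has a pole in S. When there is
   none and S is a compact subset of the domain of f, the supremum is a maximum. *)
Definition err_norm (S : set C) (r : ratfun) (f : C -> C) : \bar R :=
  ereal_sup [set (if rf_pole r z then +oo%E else (cabs (rf_eval r z - f z))%:E)
            | z in S].

End RationalFunctions.

Section Interpolation.
Variable R : realType.
Local Notation C := (Cplx R).
Variables (E : set C) (f : C -> C) (m n : nat).

Definition newton_pade (nodes : 'I_(m + n).+1 -> C) (r : ratfun R) : Prop :=
  (forall j, E (nodes j)) /\
  exists (p q : {poly C}) (v : C -> C),
    [/\ deg_le p m%:Z, deg_le q n%:Z, q != 0, holomorphic_on E v &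
      (forall z, E z -> p.[z] - q.[z] * f z = v z * \prod_j (z - nodes j)) /\
      r = FracField.tofrac p / FracField.tofrac q].

Definition interp_set (Th : set C) : set (ratfun R) :=
  [set r | exists2 nodes : 'I_(m + n).+1 -> C,
             (forall j, Th (nodes j)) & newton_pade nodes r].

Definition interp_best (Th S : set C) (r : ratfun R) : Prop :=
  interp_set Th r /\
  forall r', interp_set Th r' -> (err_norm S r f <= err_norm S r' f)%E.

End Interpolation.
Arguments newton_pade {R} E f m n nodes r.
Arguments interp_best {R} E f m n Th S r.

(* For nonempty compact K the supremum is a maximum. *)
Definition node_max (R : realType) (N : nat) (K : set (Cplx R))
    (zeta : 'I_N -> Cplx R) : R :=
  sup [set \prod_j cabs (z - zeta j) | z in K].

Definition chebyshev_nodes (R : realType) (N : nat) (K : set (Cplx R))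
    (tau : 'I_N -> Cplx R) : Prop :=
  forall zeta : 'I_N -> Cplx R, node_max K tau <= node_max K zeta.

(* Main.v *)
From HB Require Import structures.
Require Import Defs.
From mathcomp Require Import all_boot all_order all_algebra perm.
From mathcomp Require Import all_classical all_reals all_analysis.
From mathcomp Require Import complex.
From mathcomp Require Import zify ring lra.
Import Order.TTheory GRing.Theory Num.Theory.
Import numFieldNormedType.Exports.
Local Open Scope classical_set_scope.
Local Open Scope ring_scope.

(** Write N = m + n + 1, and omega for the monic polynomial with the interpolation
    nodes as its zeros. The whole asymptotics follows from one local statement
    ([newton_pade_local]): for nodes of size O(s) the Newton-Pade approximant r
    exists and, on the disc of radius s,

      r - f = (a + O(s)) omega,

    uniformly in the nodes, where a is the leading error coefficient of the Pade
    approximant. Rescaling z to e z turns the error norm on e K into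
    |a| e ^ N max_K |omega| + O(e ^ (N + 1)), with omega now formed with the rescaled nodes
    ([scaled_err_norm]). A best approximation competes with the interpolant at the
    scaled Chebyshev nodes, so its rescaled nodes minimise max_K |omega| up to O(e)
    ([best_scaled]). This gives the uniform error; and since the Chebyshev
    polynomial of a perfect compact set is unique ([chebyshev_unique]), compactness
    forces the rescaled nodes to converge to the Chebyshev nodes
    ([chebyshev_stable]), which gives the pointwise error.

    The local statement needs Taylor and divided-difference estimates for a function
    that is only assumed complex differentiable. They are derived from Cauchy's
    formula in a discrete form. Trapezoid sums are exact on affine functions,
    so Goursat's bisection argument works for them verbatim ([boundary_sum_small]);
    on circles they are means over roots of unity, and contracting the circle yields
    Cauchy's formula as a limit of finite means ([circle_mean_cauchy]). An
    ultrafilter limit makes these means one bounded linear functional L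
    ([cauchy_functional]).

    In terms of L, a function g is divisible by omega with holomorphic quotient if
    and only if the N moments L(g u ^ (k + 1) / omega), k < N, vanish
    ([newton_remainder], [moments_of_multiple]). For g = p - q f these are N linear
    equations in the N + 1 coefficients of p and q, whose matrix is Lipschitz in the
    nodes. At the origin the solution normalised by q(0) = 1 is unique, because the
    Pade approximant is non-degenerate ([pade_uniq]); hence every nonzero solution of a
    nearby system can be normalised, and is then O(s)-close ([solution_close]). *)

(** * The real modulus *)

Section Modulus.
Context {R : realType}.
Local Notation C := (Cplx R).
Implicit Types (x y z : C).

Lemma cabsE z : toC (cabs z) = `|z|.
Proof. by []. Qed.

Lemma toC_inj : injective (@toC R).
Proof. exact: complexI. Qed.

Lemma toC0 : toC (0 : R) = 0. Proof. by []. Qed.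
Lemma toC1 : toC (1 : R) = 1. Proof. by []. Qed.
Lemma toCD (s t : R) : toC (s + t) = toC s + toC t. Proof. exact: rmorphD. Qed.
Lemma toCB (s t : R) : toC (s - t) = toC s - toC t. Proof. exact: rmorphB. Qed.
Lemma toCM (s t : R) : toC (s * t) = toC s * toC t. Proof. exact: rmorphM. Qed.
Lemma toCX (s : R) k : toC (s ^+ k) = toC s ^+ k. Proof. exact: rmorphXn. Qed.
Lemma toCV (s : R) : toC s^-1 = (toC s)^-1. Proof. exact: fmorphV. Qed.
Lemma toC_nat k : toC (k%:R : R) = k%:R. Proof. exact: rmorph_nat. Qed.
Lemma toC_eq0 (s : R) : (toC s == 0) = (s == 0).
Proof. by rewrite -[0]toC0 (inj_eq toC_inj). Qed.
Lemma le_toC (s t : R) : (toC s <= toC t) = (s <= t). Proof. exact: lecR. Qed.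
Lemma lt_toC (s t : R) : (toC s < toC t) = (s < t). Proof. exact: ltcR. Qed.

Lemma lt_cabs x (t : R) : (`|x| < toC t) = (cabs x < t).
Proof. by rewrite -cabsE lt_toC. Qed.

Lemma cabs_ge0 z : 0 <= cabs z. Proof. by rewrite -le_toC cabsE toC0. Qed.
Lemma cabs0 : cabs (0 : C) = 0. Proof. by apply: toC_inj; rewrite cabsE normr0. Qed.
Lemma cabs1 : cabs (1 : C) = 1. Proof. by apply: toC_inj; rewrite cabsE normr1. Qed.
Lemma cabs_eq0 z : (cabs z == 0) = (z == 0).
Proof. by rewrite -(inj_eq toC_inj) cabsE toC0 normr_eq0. Qed.
Lemma cabs_gt0 z : (0 < cabs z) = (z != 0).
Proof. by rewrite lt_def cabs_ge0 andbT cabs_eq0. Qed.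
Lemma cabsN z : cabs (- z) = cabs z. Proof. by apply: toC_inj; rewrite !cabsE normrN. Qed.
Lemma cabsBC x y : cabs (x - y) = cabs (y - x). Proof. by rewrite -cabsN opprB. Qed.
Lemma cabsM x y : cabs (x * y) = cabs x * cabs y.
Proof. by apply: toC_inj; rewrite toCM !cabsE normrM. Qed.
Lemma cabsV z : cabs z^-1 = (cabs z)^-1.
Proof. by apply: toC_inj; rewrite toCV !cabsE normfV. Qed.
Lemma cabsX z k : cabs (z ^+ k) = cabs z ^+ k.
Proof. by apply: toC_inj; rewrite toCX !cabsE normrX. Qed.
Lemma cabsD x y : cabs (x + y) <= cabs x + cabs y.
Proof. by rewrite -le_toC toCD !cabsE ler_normD. Qed.
Lemma cabsB x y : cabs (x - y) <= cabs x + cabs y.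
Proof. by rewrite -(cabsN y) cabsD. Qed.
Lemma cabs_sub_ge x y : cabs x - cabs y <= cabs (x - y).
Proof. by rewrite lerBlDr -{1}(subrK y x) cabsD. Qed.
Lemma cabs_dist x y : `|cabs x - cabs y| <= cabs (x - y).
Proof.
by rewrite ler_norml cabs_sub_ge andbT lerNl opprB cabsBC cabs_sub_ge.
Qed.
Lemma cabs_toC (t : R) : cabs (toC t) = `|t|.
Proof. by apply: toC_inj; rewrite cabsE normc_def /= expr0n addr0 sqrtr_sqr. Qed.
Lemma cabs_nat k : cabs (k%:R : C) = k%:R.
Proof. by rewrite -toC_nat cabs_toC ger0_norm. Qed.
Lemma cabs_sum (I : Type) (s : seq I) (P : pred I) (F : I -> C) :
  cabs (\sum_(i <- s | P i) F i) <= \sum_(i <- s | P i) cabs (F i).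
Proof.
elim/big_rec2: _ => [|i u v _ le_vu]; first by rewrite cabs0.
by rewrite (le_trans (cabsD _ _))// lerD2l.
Qed.
Lemma cabs_prod (I : Type) (s : seq I) (P : pred I) (F : I -> C) :
  cabs (\prod_(i <- s | P i) F i) = \prod_(i <- s | P i) cabs (F i).
Proof.
by elim/big_rec2: _ => [|i u v _ <-]; rewrite ?cabs1 ?cabsM.
Qed.

(** Balls of the complex field have complex radii; positive ones are real, which
    is why every estimate below can be carried out in R with [cabs]. *)
Lemma lt_toC_exists (d : C) : 0 < d -> exists2 t : R, 0 < t & d = toC t.
Proof.
move=> d0; exists (complex.Re d); last by rewrite /toC RRe_real ?gtr0_real.
by move: d0; rewrite ltcE /= => /andP[].
Qed.

Lemma nbhs_cabs (z : C) (A : set C) :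
  nbhs z A <-> exists2 d : R, 0 < d & forall y, cabs (y - z) < d -> A y.
Proof.
split=> [/nbhs_ballP[e /= e0 sA]|[d d0 sA]].
- have [t t0 et] := @lt_toC_exists _ e0.
  exists t => // y yz; apply: sA; rewrite /ball/= et distrC.
  by rewrite lt_cabs.
- apply/nbhs_ballP; exists (toC d) => /=; first by rewrite lt_toC.
  by move=> y; rewrite /ball/= distrC lt_cabs => /sA.
Qed.

Lemma near_cabs (z : C) (P : C -> Prop) :
  (\forall y \near z, P y) <-> exists2 d : R, 0 < d & forall y, cabs (y - z) < d -> P y.
Proof. exact: nbhs_cabs. Qed.

Lemma cvg_cabs (T : Type) (F : set_system T) (FF : Filter F) (g : T -> C) (l : C) :
  g @ F --> l <-> forall eta : R, 0 < eta -> \forall t \near F, cabs (g t - l) < eta.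
Proof.
split=> [/cvgrPdist_lt gl eta eta0|gl].
- have := gl (toC eta); rewrite lt_toC => /(_ eta0).
  by apply: filterS => t; rewrite distrC lt_cabs.
- apply/cvgrPdist_lt => e /lt_toC_exists [t t0 ->].
  by apply: filterS (gl t t0) => s; rewrite distrC lt_cabs.
Qed.

End Modulus.

(** * Complex derivatives *)

Section Derivative.
Context {R : realType}.
Local Notation C := (Cplx R).

Lemma derivable_cabsP (g : C -> C) (z : C) :
  derivable g z 1 <->
  exists c : C, forall eta : R, 0 < eta -> exists2 d : R, 0 < d &
    forall y, cabs (y - z) < d ->
      cabs (g y - g z - c * (y - z)) <= eta * cabs (y - z).
Proof.
have quot (c h : C) : h != 0 ->
    cabs (h^-1 *: (g (h *: (1 : C) + z) - g z) - c) * cabs h =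
    cabs (g (h + z) - g z - c * h).
  move=> h0; rewrite -cabsM; congr cabs.
  by rewrite /GRing.scale/= mulr1 mulrBl mulrAC mulVf// mul1r.
split.
- move=> dg.
  exists (lim ((fun h => h^-1 *: (g (h *: (1 : C) + z) - g z)) @ 0^')) => eta eta0.
  move/cvg_cabs : (dg : cvg _) => /(_ eta eta0); set c := lim _.
  rewrite near_withinE => /near_cabs[d d0 dP]; exists d => // y yz.
  have [->|zy] := eqVneq y z; first by rewrite !subrr mulr0 subrr !cabs0 mulr0.
  have h0 : y - z != 0 by rewrite subr_eq0.
  have := dP (y - z); rewrite subr0 => /(_ yz h0) /ltW.
  move/(ler_wpM2r (cabs_ge0 (y - z))).
  by rewrite quot// subrK.
- move=> [c cP]; apply/cvg_ex; exists c; apply/cvg_cabs => eta eta0.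
  have eta2 : 0 < eta / 2 by rewrite divr_gt0.
  have [d d0 dP] := cP _ eta2.
  rewrite near_withinE; apply/near_cabs; exists d => // h; rewrite subr0 => hd h0.
  have := dP (h + z); rewrite addrK => /(_ hd).
  rewrite -quot// ler_pM2r ?cabs_gt0// => /le_lt_trans; apply.
  by rewrite ltr_pdivrMr// ltr_pMr// ltr1n.
Qed.

End Derivative.

(** * Trapezoid sums and Goursat's theorem *)

Section Trapezoid.
Context {R : realType}.
Local Notation C := (Cplx R).
Variable h : C -> C.

(** The sum is defined by halving the parameter interval, so that bisection of a
    path is an identity between sums rather than a limit statement. *)
Fixpoint trapezoid (phi : R -> C) (k : nat) (x l : R) : C :=
  if k is k'.+1 then
    trapezoid phi k' x (l / 2) + trapezoid phi k' (x + l / 2) (l / 2)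
  else (h (phi x) + h (phi (x + l))) / 2 * (phi (x + l) - phi x).

(** On the integrand a + b z every panel contributes exactly the increment of
    a z + b z^2 / 2, so the sum telescopes at every refinement level k at once;
    only the deviation of h from an affine function is left to estimate. *)
Lemma trapezoid_affine (phi : R -> C) (a b : C) (B Lam : R) k x l :
  0 <= l -> 0 <= B -> 
  (forall t : R, x <= t <= x + l -> cabs (h (phi t) - (a + b * phi t)) <= B) ->
  (forall s t : R, x <= s <= x + l -> x <= t <= x + l ->
     cabs (phi s - phi t) <= Lam * `|s - t|) ->
  cabs (trapezoid phi k x l -
    ((a * phi (x + l) + b * phi (x + l) ^+ 2 / 2) - (a * phi x + b * phi x ^+ 2 / 2)))
  <= B * Lam * l.
Proof.
elim: k x l => [|k IH] x l l0 B0 hB hL /=.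
- have xin : x <= x <= x + l by rewrite lexx lerDl.
  have xlin : x <= x + l <= x + l by rewrite lexx lerDl l0.
  set u := phi x; set v := phi (x + l).
  have -> : (h u + h v) / 2 * (v - u) - (a * v + b * v ^+ 2 / 2 - (a * u + b * u ^+ 2 / 2))
    = ((h u - (a + b * u)) + (h v - (a + b * v))) / 2 * (v - u) by field.
  rewrite cabsM -mulrA ler_pM ?cabs_ge0//.
  + rewrite cabsM cabsV cabs_nat.
    rewrite ler_pdivrMr// (le_trans (cabsD _ _))// mulr2n mulrDr mulr1 lerD//; exact: hB.
  + by rewrite (le_trans (hL _ _ xlin xin))// addrAC subrr add0r (ger0_norm l0).
- have l20 : 0 <= l / 2 by rewrite divr_ge0.
  have e1 : x + l / 2 + l / 2 = x + l by field.
  have e2 : x + l / 2 <= x + l by rewrite lerD2l ler_pdivrMr// ler_peMr// ler1n.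
  have e3 : x <= x + l / 2 by rewrite lerDl.
  have H1 : cabs _ <= _ := IH x (l / 2) l20 B0 _ _.
  have H2 : cabs _ <= _ := IH (x + l / 2) (l / 2) l20 B0 _ _.
  have {}H1 := H1 _ _; have {}H2 := H2 _ _.
  rewrite e1 in H2.
  set G := fun u => a * phi u + b * phi u ^+ 2 / 2.
  rewrite -/(G (x + l)) -/(G x).
  rewrite -/(G (x + l)) -/(G (x + l / 2)) in H2.
  rewrite -/(G (x + l / 2)) -/(G x) in H1.
  set A1 := trapezoid _ _ _ _; set A2 := trapezoid _ _ _ _.
  have -> : A1 + A2 - (G (x + l) - G x) =
    (A1 - (G (x + l / 2) - G x)) + (A2 - (G (x + l) - G (x + l / 2))) by ring.
  have -> : B * Lam * l = B * Lam * (l / 2) + B * Lam * (l / 2) by field.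
  apply: (le_trans (cabsD _ _)); apply: lerD.
  + apply: H1 => [t /andP[t1 t2]|s t /andP[s1 s2] /andP[t1 t2]].
      by apply: hB; rewrite t1 (le_trans t2).
    by apply: hL; rewrite ?s1 ?t1/= ?(le_trans s2) ?(le_trans t2).
  + apply: H2 => [t /andP[t1 t2]|s t /andP[s1 s2] /andP[t1 t2]].
      by apply: hB; rewrite t2 (le_trans _ t1).
    by apply: hL; rewrite ?s2 ?t2 ?andbT ?(le_trans _ s1) ?(le_trans _ t1).
Qed.

Lemma trapezoid_bound (phi : R -> C) (B Lam : R) k x l :
  0 <= l -> 0 <= B ->
  (forall t : R, x <= t <= x + l -> cabs (h (phi t)) <= B) ->
  (forall s t : R, x <= s <= x + l -> x <= t <= x + l ->
     cabs (phi s - phi t) <= Lam * `|s - t|) ->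
  cabs (trapezoid phi k x l) <= B * Lam * l.
Proof.
move=> l0 B0 hB hL.
have := @trapezoid_affine phi 0 0 B Lam k x l l0 B0 _ hL.
rewrite !mul0r !addr0 !subr0; apply => t tin.
by rewrite mul0r addr0 subr0 hB.
Qed.

Lemma trapezoid_sum (phi : R -> C) k x l :
  trapezoid phi k x l = \sum_(j < 2 ^ k)
    (h (phi (x + j%:R * (l / 2 ^+ k))) + h (phi (x + j.+1%:R * (l / 2 ^+ k)))) / 2
    * (phi (x + j.+1%:R * (l / 2 ^+ k)) - phi (x + j%:R * (l / 2 ^+ k))).
Proof.
elim: k x l => [|k IH] x l /=.
  by rewrite expn0 big_ord1 !mul0r !addr0 mul1r expr0 divr1.
rewrite !IH expnS mul2n -addnn big_split_ord/=.
have e : l / 2 / 2 ^+ k = l / 2 ^+ k.+1 by rewrite exprS invfM mulrA.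
congr (_ + _); apply: eq_bigr => j _ /=; rewrite e//.
have ej (i : nat) : x + l / 2 + i%:R * (l / 2 ^+ k.+1) = x + (2 ^ k + i)%:R * (l / 2 ^+ k.+1).
  rewrite natrD mulrDl addrA natrX; congr (_ + _ + _).
  by rewrite exprS; field; rewrite expf_neq0.
by rewrite -addnS !ej.
Qed.

End Trapezoid.

Lemma nested_intervals (R : realType) (a l : nat -> R) :
  (forall i, a i <= a i.+1) -> (forall i, a i.+1 + l i.+1 <= a i + l i) ->
  (forall i, 0 <= l i) ->
  exists x, forall i, a i <= x <= a i + l i.
Proof.
move=> ai al l0.
have aij i k : a i <= a (i + k)%N.
  by elim: k => [|k IH]; rewrite ?addn0// addnS (le_trans IH).
have alij i k : a (i + k)%N + l (i + k)%N <= a i + l i.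
  by elim: k => [|k IH]; rewrite ?addn0// addnS (le_trans (al _)).
have ub i j : a j <= a i + l i.
  have [/subnKC <-|/ltnW /subnKC ij] := leqP i j.
    by rewrite (le_trans _ (alij i (j - i)%N))// lerDl.
  by rewrite (le_trans (aij j (i - j)%N))// ij lerDl.
have hs : has_sup (range a).
  split; first by exists (a 0%N), 0%N.
  by exists (a 0%N + l 0%N) => _ [j _ <-].
exists (sup (range a)) => i; apply/andP; split.
  by apply: sup_upper_bound => //; exists i.
by apply: ge_sup; [exists (a 0%N), 0%N|move=> _ [j _ <-]].
Qed.

Lemma half_pow_small (R : realType) (d : R) : 0 < d -> exists i : nat, 2 ^- i < d.
Proof.
move=> d0; have [k kP] : exists k : nat, d^-1 < k%:R.
  by exists (Num.bound d^-1); rewrite archi_boundP// invr_ge0 ltW.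
exists k; rewrite -[d]invrK ltf_pV2 ?posrE ?invr_gt0 ?exprn_gt0//.
by rewrite (lt_trans kP)// -natrX ltr_nat ltn_expl.
Qed.

Section Goursat.
Context {R : realType}.
Local Notation C := (Cplx R).
Variables (h : C -> C) (Phi : R -> R -> C).

Definition boundary_sum k (x y l : R) : C :=
  trapezoid h (fun s => Phi s y) k x l + trapezoid h (Phi (x + l)) k y l
  - trapezoid h (fun s => Phi s (y + l)) k x l - trapezoid h (Phi x) k y l.

(** The contributions of the four inner edges cancel in pairs. *)
Lemma boundary_sum_split k (x y l : R) :
  boundary_sum k.+1 x y l =
  boundary_sum k x y (l / 2) + boundary_sum k (x + l / 2) y (l / 2)
  + (boundary_sum k x (y + l / 2) (l / 2) + boundary_sum k (x + l / 2) (y + l / 2) (l / 2)).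
Proof.
rewrite /boundary_sum /=.
have -> : x + l / 2 + l / 2 = x + l by field.
have -> : y + l / 2 + l / 2 = y + l by field.
ring.
Qed.

(** The increments of the primitive a z + b z^2 / 2 around the square add up to 0,
    so each of the four sides contributes at most its deviation B Lam l. *)
Lemma boundary_sum_affine (a b : C) (B Lam : R) k x y l :
  0 <= l -> 0 <= B ->
  (forall s t : R, x <= s <= x + l -> y <= t <= y + l ->
     cabs (h (Phi s t) - (a + b * Phi s t)) <= B) ->
  (forall s t s' t' : R, x <= s <= x + l -> x <= s' <= x + l ->
     y <= t <= y + l -> y <= t' <= y + l ->
     cabs (Phi s t - Phi s' t') <= Lam * (`|s - s'| + `|t - t'|)) ->
  cabs (boundary_sum k x y l) <= 4 * (B * Lam * l).
Proof.
move=> l0 B0 hB hL.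
have xin : x <= x <= x + l by rewrite lexx lerDl.
have xlin : x <= x + l <= x + l by rewrite lexx lerDl l0.
have yin : y <= y <= y + l by rewrite lexx lerDl.
have ylin : y <= y + l <= y + l by rewrite lexx lerDl l0.
have Hx t : y <= t <= y + l -> cabs _ <= B * Lam * l := fun tin =>
  @trapezoid_affine _ h (fun s => Phi s t) a b B Lam k x l l0 B0
    (fun s sin => hB s t sin tin) (fun s s' sin sin' =>
      ltac:(by have := hL s t s' t sin sin' tin tin; rewrite subrr normr0 addr0)).
have Hy s : x <= s <= x + l -> cabs _ <= B * Lam * l := fun sin =>
  @trapezoid_affine _ h (Phi s) a b B Lam k y l l0 B0
    (fun t tin => hB s t sin tin) (fun t t' tin tin' =>
      ltac:(by have := hL s t s t' sin sin tin tin'; rewrite subrr normr0 add0r)).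
have := Hx _ yin; have := Hx _ ylin; have := Hy _ xin; have := Hy _ xlin.
rewrite /boundary_sum.
set G := fun u : C => a * u + b * u ^+ 2 / 2.
rewrite -!/(G _).
set T1 := trapezoid _ _ _ _ _; set T2 := trapezoid _ _ _ _ _.
set T3 := trapezoid _ _ _ _ _; set T4 := trapezoid _ _ _ _ _.
move=> h1 h2 h3 h4.
have -> : T4 + T1 - T3 - T2 =
  (T4 - (G (Phi (x + l) y) - G (Phi x y)))
  + (T1 - (G (Phi (x + l) (y + l)) - G (Phi (x + l) y)))
  - (T3 - (G (Phi (x + l) (y + l)) - G (Phi x (y + l))))
  - (T2 - (G (Phi x (y + l)) - G (Phi x y))) by ring.
apply: (le_trans (cabsB _ _)).
apply: (le_trans (lerD (le_trans (cabsB _ _) (lerD (cabsD _ _) (lexx _))) (lexx _))).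
lra.
Qed.

Hypothesis Phi_lip : exists2 Lam : R, 0 < Lam & forall s t s' t' : R,
  0 <= s <= 1 -> 0 <= s' <= 1 -> 0 <= t <= 1 -> 0 <= t' <= 1 ->
  cabs (Phi s t - Phi s' t') <= Lam * (`|s - s'| + `|t - t'|).
Hypothesis h_deriv : forall s t : R, 0 <= s <= 1 -> 0 <= t <= 1 -> derivable h (Phi s t) 1.

(** The bound is proportional to the area, hence stable under gluing four quarters. *)
Let good (c x y l : R) := exists k0, forall k, (k0 <= k)%N ->
  cabs (boundary_sum k x y l) <= c * l ^+ 2.

Lemma good_split (c x y l : R) :
  good c x y (l / 2) -> good c (x + l / 2) y (l / 2) ->
  good c x (y + l / 2) (l / 2) -> good c (x + l / 2) (y + l / 2) (l / 2) ->
  good c x y l.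
Proof.
move=> [k1 H1] [k2 H2] [k3 H3] [k4 H4].
exists (k1 + k2 + k3 + k4).+1 => -[//|k] lek.
have le1 : (k1 <= k)%N by lia.
have le2 : (k2 <= k)%N by lia.
have le3 : (k3 <= k)%N by lia.
have le4 : (k4 <= k)%N by lia.
move: {H1}(H1 _ le1) {H2}(H2 _ le2) {H3}(H3 _ le3) {H4}(H4 _ le4).
rewrite boundary_sum_split.
set A1 := boundary_sum _ _ _ _; set A2 := boundary_sum _ _ _ _.
set A3 := boundary_sum _ _ _ _; set A4 := boundary_sum _ _ _ _.
move=> H1 H2 H3 H4.
apply: (le_trans (cabsD _ _)).
apply: (le_trans (lerD (cabsD _ _) (cabsD _ _))).
have -> : c * l ^+ 2 = c * (l / 2) ^+ 2 + c * (l / 2) ^+ 2 + (c * (l / 2) ^+ 2 + c * (l / 2) ^+ 2).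
  by field.
by rewrite !lerD.
Qed.

Lemma bad_square_chain (c : R) : ~ good c 0 0 1 ->
  exists u : nat -> R * R, u 0%N = (0, 0) /\ forall i,
    [/\ ~ good c (u i).1 (u i).2 (2 ^- i),
        (u i).1 <= (u i.+1).1, (u i.+1).1 + 2 ^- i.+1 <= (u i).1 + 2 ^- i,
        (u i).2 <= (u i.+1).2 & (u i.+1).2 + 2 ^- i.+1 <= (u i).2 + 2 ^- i].
Proof.
move=> bad0.
have step (ip : nat * (R * R)) : exists q : R * R, ~ good c ip.2.1 ip.2.2 (2 ^- ip.1) ->
    [/\ ~ good c q.1 q.2 (2 ^- ip.1.+1),
        ip.2.1 <= q.1, q.1 + 2 ^- ip.1.+1 <= ip.2.1 + 2 ^- ip.1,
        ip.2.2 <= q.2 & q.2 + 2 ^- ip.1.+1 <= ip.2.2 + 2 ^- ip.1].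
  case: ip => i [x y] /=; have [gd|bad] := pselect (good c x y (2 ^- i)).
    by exists (0, 0).
  have el : (2 : R) ^- i.+1 = 2 ^- i / 2 by rewrite exprSr invfM mulrC.
  rewrite el; set l := 2 ^- i in bad *.
  have l0 : 0 < l by rewrite invr_gt0 exprn_gt0.
  apply: contrapT => nex; apply: bad; apply: good_split; apply: contrapT => bad;
    apply: nex.
  - by exists (x, y) => _ /=; split=> //; lra.
  - by exists (x + l / 2, y) => _ /=; split=> //; lra.
  - by exists (x, y + l / 2) => _ /=; split=> //; lra.
  - by exists (x + l / 2, y + l / 2) => _ /=; split=> //; lra.
have [nxt nxtP] := boolp.choice step.
pose u := fix u i := if i is j.+1 then nxt (j, u j) else (0, 0).
have ubad i : ~ good c (u i).1 (u i).2 (2 ^- i).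
  elim: i => [|i IH] /=; first by rewrite expr0 invr1.
  by case: (nxtP (i, u i) IH).
by exists u; split => // i; have [? ? ? ? ?] := nxtP (i, u i) (ubad i); split.
Qed.

(** Goursat's bisection argument. Were the boundary sums not eventually small
    relative to the area, this would persist on a nested chain of squares. At the
    limit point h has a first-order expansion, so on a small square it is affine up
    to a small multiple of the diameter, and [boundary_sum_affine] bounds the sums
    of all levels simultaneously. *)
Lemma boundary_sum_small (eta : R) : 0 < eta ->
  exists k0, forall k, (k0 <= k)%N -> cabs (boundary_sum k 0 0 1) <= eta.
Proof.
move=> eta0; have [Lam Lam0 hL] := Phi_lip.
suff: good eta 0 0 1 by rewrite /good expr1n mulr1.
apply: contrapT => /bad_square_chain[u [u0 uP]].
have l0 i : 0 <= (2 : R) ^- i by rewrite invr_ge0 exprn_ge0.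
have [x xP] := @nested_intervals R (fun i => (u i).1) (fun i => 2 ^- i)
  (fun i => let: And5 _ e _ _ _ := uP i in e)
  (fun i => let: And5 _ _ e _ _ := uP i in e) l0.
have [y yP] := @nested_intervals R (fun i => (u i).2) (fun i => 2 ^- i)
  (fun i => let: And5 _ _ _ e _ := uP i in e)
  (fun i => let: And5 _ _ _ _ e := uP i in e) l0.
have u1ge i : 0 <= (u i).1 /\ (u i).1 + 2 ^- i <= 1.
  elim: i => [|i [IH1 IH2]]; first by rewrite u0 expr0 invr1 add0r.
  have [_ A B _ _] := uP i; split; first exact: le_trans A.
  exact: le_trans IH2.
have u2ge i : 0 <= (u i).2 /\ (u i).2 + 2 ^- i <= 1.
  elim: i => [|i [IH1 IH2]]; first by rewrite u0 expr0 invr1 add0r.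
  have [_ _ _ A B] := uP i; split; first exact: le_trans A.
  exact: le_trans IH2.
have xin : 0 <= x <= 1.
  by have := xP 0%N; rewrite u0 expr0 invr1 add0r.
have yin : 0 <= y <= 1.
  by have := yP 0%N; rewrite u0 expr0 invr1 add0r.
have /derivable_cabsP[c hc] := h_deriv _ _ xin yin.
(* On a square of side l the image has diameter at most 2 Lam l, so the four sides
   contribute at most 4 (eta' 2 Lam l) (Lam l) = eta l^2. *)
pose eta' := eta / (8 * Lam ^+ 2).
have Lam20 : 0 < Lam ^+ 2 by rewrite exprn_gt0.
have eta'0 : 0 < eta' by rewrite divr_gt0// mulr_gt0.
have [d d0 hd] := hc _ eta'0.
have [i ilt] : exists i : nat, 2 ^- i < d / (2 * Lam).
  by apply: half_pow_small; rewrite divr_gt0// mulr_gt0.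
have [bad _ _ _ _] := uP i; apply: bad; exists 0%N => k _.
set z := Phi x y in hd hc; set l := 2 ^- i in ilt *.
have lp : 0 <= l := l0 i.
have [u10 u11] := u1ge i; have [u20 u21] := u2ge i.
rewrite -/l in u11 u21.
have := xP i; have := yP i; rewrite -/l => yi xi.
have near_pt s t : (u i).1 <= s <= (u i).1 + l -> (u i).2 <= t <= (u i).2 + l ->
    cabs (Phi s t - z) <= 2 * Lam * l.
  move=> sin tin; rewrite /z.
  apply: (le_trans (hL _ _ _ _ _ _ _ _)) => //; try lra.
  rewrite mulrAC [_ * Lam]mulrC ler_wpM2l ?(ltW Lam0)//.
  have -> : 2 * l = l + l by rewrite mulr_natl.
  by apply: lerD; rewrite ler_norml; lra.
have -> : eta * l ^+ 2 = 4 * ((eta' * (2 * Lam * l)) * Lam * l).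
  by rewrite /eta'; field; rewrite gt_eqF.
apply: (@boundary_sum_affine (h z - c * z) c) => //.
- apply: mulr_ge0; first exact: ltW eta'0.
  by apply: mulr_ge0 => //; apply: mulr_ge0 => //; exact: ltW Lam0.
- move=> s t sin tin.
  have -> : h (Phi s t) - (h z - c * z + c * Phi s t) = h (Phi s t) - h z - c * (Phi s t - z).
    by ring.
  have nz := near_pt _ _ sin tin.
  apply: (le_trans (hd _ _)).
    rewrite (le_lt_trans nz)// mulrC.
    by move: ilt; rewrite ltr_pdivlMr// mulr_gt0.
  by apply: ler_wpM2l nz; exact: ltW eta'0.
- move=> s t s' t' sin s'in tin t'in.
  by apply: hL; lra.
Qed.

End Goursat.

(** * Means over roots of unity *)

Section Circle.
Context {R : realType}.
Local Notation C := (Cplx R).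

Lemma cos_lip (s t : R) : `|cos s - cos t| <= `|s - t|.
Proof.
wlog st : s t / t <= s => [H|].
  have [|ts] := leP t s; first exact: H.
  by rewrite distrC (distrC s); apply: H; exact: ltW.
have [c _ ->] := @MVT_segment R cos (fun x => - sin x) t s st
  (fun x _ => is_derive_cos x) (continuous_subspaceT (@continuous_cos R)).
rewrite normrM normrN ler_piMl// ler_norml.
by rewrite sin_geN1 sin_le1.
Qed.

Lemma sin_lip (s t : R) : `|sin s - sin t| <= `|s - t|.
Proof.
wlog st : s t / t <= s => [H|].
  have [|ts] := leP t s; first exact: H.
  by rewrite distrC (distrC s); apply: H; exact: ltW.
have [c _ ->] := @MVT_segment R sin cos t s st
  (fun x _ => is_derive_sin x) (continuous_subspaceT (@continuous_sin R)).
rewrite normrM ler_piMl// ler_norml.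
by rewrite cos_geN1 cos_le1.
Qed.

Lemma cabs_Complex (u v : R) : cabs (Complex u v : C) <= `|u| + `|v|.
Proof.
have -> : (Complex u v : C) = toC u + 'i%C * toC v.
  by rewrite /toC [LHS]complexE.
rewrite (le_trans (cabsD _ _))// cabsM !cabs_toC.
have -> : cabs ('i%C : C) = 1; last by rewrite mul1r.
by rewrite /cabs/= expr0n add0r expr1n sqrtr1.
Qed.

Definition circ (t : R) : C := Complex (cos (t * (pi *+ 2))) (sin (t * (pi *+ 2))).

Lemma circD s t : circ (s + t) = circ s * circ t.
Proof.
rewrite /circ mulrDl cosD sinD; apply/eqP; rewrite eq_complex /= eqxx /=.
by rewrite addrC (mulrC (cos _)).
Qed.

Lemma circ0 : circ 0 = 1.
Proof. by rewrite /circ mul0r cos0 sin0. Qed.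

Lemma circ1 : circ 1 = 1.
Proof. by rewrite /circ mul1r cos2pi sin2pi. Qed.

Lemma circ_half : circ 2^-1 = -1.
Proof.
rewrite /circ; have -> : (2 : R)^-1 * (pi *+ 2) = pi.
  by rewrite -[pi *+ 2]mulr_natl mulrA mulVf// mul1r.
by rewrite cospi sinpi; apply/eqP; rewrite eq_complex /= oppr0 !eqxx.
Qed.

Lemma cabs_circ t : cabs (circ t) = 1.
Proof. by rewrite /cabs/= cos2Dsin2 sqrtr1. Qed.

Lemma circ_neq0 t : circ t != 0.
Proof. by rewrite -cabs_gt0 cabs_circ. Qed.

Lemma circ_lip s t : cabs (circ s - circ t) <= 4 * pi * `|s - t|.
Proof.
have -> : circ s - circ t = Complex (cos (s * (pi *+ 2)) - cos (t * (pi *+ 2)))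
   (sin (s * (pi *+ 2)) - sin (t * (pi *+ 2))) by [].
rewrite (le_trans (cabs_Complex _ _))//.
rewrite (le_trans (lerD (cos_lip _ _) (sin_lip _ _)))// -mulrBl normrM.
have p0 := @pi_ge0 R.
have p20 : 0 <= pi *+ 2 :> R by rewrite mulrn_wge0.
rewrite (ger0_norm p20).
set p := pi; have -> : p *+ 2 = 2 * p by rewrite mulr_natl.
by rewrite le_eqVlt; apply/orP; left; apply/eqP; ring.
Qed.

Lemma circX t k : circ t ^+ k = circ (k%:R * t).
Proof.
elim: k => [|k IH]; first by rewrite expr0 mul0r circ0.
by rewrite exprS IH -circD; congr circ; rewrite -natr1 mulrDl mul1r addrC.
Qed.

Let om (k : nat) : C := circ (2 ^- k).

Lemma om_pow k : om k ^+ (2 ^ k) = 1.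
Proof. by rewrite circX natrX mulfV ?circ1// expf_neq0. Qed.

Lemma om_half k : om k.+1 ^+ (2 ^ k) = -1.
Proof.
rewrite circX natrX -circ_half; congr circ.
by rewrite exprS invfM mulrCA mulfV ?mulr1// expf_neq0.
Qed.

(** A smaller order would divide half of 2 ^ k, where the power is -1. *)
Lemma om_primitive k : (2 ^ k).-primitive_root (om k).
Proof.
have [m pm /(dvdn_pfactor _ _ (erefl : prime 2))[a ak mE]] :=
  prim_order_exists (expn_gt0 2 k) (om_pow k).
case: (ltngtP a k) ak => // [ak _|eqak _]; last by rewrite mE eqak in pm.
case: k => // k in pm ak *; exfalso.
have : om k.+1 ^+ (2 ^ k) = 1.
  apply/eqP; rewrite -(prim_order_dvd pm) mE dvdn_exp2l//.
rewrite om_half => /eqP; rewrite -subr_eq0 -opprD oppr_eq0.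
by rewrite -(natrD _ 1 1) pnatr_eq0.
Qed.

Definition circle_mean (rho : R) (k : nat) (h : C -> C) : C :=
  (2 ^ k)%:R^-1 * \sum_(j < 2 ^ k) h (toC rho * circ (j%:R / 2 ^+ k)).

Lemma sum_shift (F : nat -> C) n :
  \sum_(i < n) F i.+1 = \sum_(i < n) F i + (F n - F 0%N).
Proof.
elim: n => [|n IH]; first by rewrite !big_ord0 subrr addr0.
by rewrite !big_ord_recr /= IH; ring.
Qed.

(** On the 2 ^ k vertices of the regular polygon consecutive points differ by the
    factor om, so summation by parts turns the trapezoid sum of h into a multiple
    of the mean of h(u) u. *)
Lemma trapezoid_circle (rho : R) k (h : C -> C) : (0 < k)%N ->
  trapezoid h (fun t => toC rho * circ t) k 0 1 =
  (om k - (om k)^-1) / 2 * (2 ^ k)%:R * circle_mean rho k (fun u => h u * u).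
Proof.
move=> k0; rewrite trapezoid_sum /circle_mean -mulrA mulVKf ?pnatr_eq0 ?expn_eq0//.
pose a j := toC rho * circ (j%:R / 2 ^+ k).
have aS j : a j.+1 = a j * om k.
  by rewrite /a /om -mulrA -circD -natr1 mulrDl mul1r.
have an : a (2 ^ k)%N = a 0%N.
  by rewrite /a natrX mulfV ?expf_neq0// mul0r circ0 circ1.
transitivity (\sum_(j < 2 ^ k) (h (a j) + h (a j.+1)) / 2 * (a j.+1 - a j)).
  by apply: eq_bigr => j _; rewrite !add0r !div1r.
pose H j := h (a j) * a j.
have o0 : om k != 0 by exact: circ_neq0.
transitivity (\sum_(j < 2 ^ k) (H j * ((om k - 1) / 2) + H j.+1 * ((1 - (om k)^-1) / 2))).
  apply: eq_bigr => j _; rewrite /H.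
  have -> : a j = a j.+1 / om k by rewrite aS mulfK.
  by field.
rewrite big_split /= -!mulr_suml sum_shift /H an subrr addr0 -mulrDr mulrC.
by congr (_ * _); rewrite -mulrDl addrA subrK.
Qed.

(** The factor of [trapezoid_circle] stays away from 0: 2 ^ k chords of length
    |w ^ 2 - 1| lead from 1 to -1, hence 2 <= 2 ^ k |w ^ 2 - 1|. *)
Lemma chord_lb k : 1 <= cabs ((om k.+2 - (om k.+2)^-1) / 2 * (2 ^ k.+2)%:R).
Proof.
set w := om k.+2; have w0 : w != 0 by exact: circ_neq0.
have cw : cabs w = 1 by exact: cabs_circ.
have -> : (w - w^-1) / 2 * (2 ^ k.+2)%:R = 2 * ((2 ^ k)%:R * (w ^+ 2 - 1)) / w.
  by rewrite !expnS !natrM; field.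
rewrite !cabsM cabsV cw invr1 mulr1 !cabs_nat.
suff : 2 <= (2 ^ k)%:R * cabs (w ^+ 2 - 1) by lra.
have -> : (2 : R) = cabs ((w ^+ 2) ^+ (2 ^ k) - 1).
  by rewrite -exprM -expnS om_half -opprD cabsN -(natrD _ 1 1) cabs_nat.
rewrite subrX1 cabsM mulrC ler_wpM2r ?cabs_ge0// (le_trans (cabs_sum _ _ _ _))//.
under eq_bigr do rewrite !cabsX cw !expr1n.
by rewrite sumr_const card_ord.
Qed.

(** u / (u - z) times 1 - (z / u) ^ n is a geometric sum in z / u, and only its
    constant term has a nonzero mean over the n-th roots of unity. *)
Lemma circle_mean_kernel (rho : R) (z : C) k : 0 < rho -> cabs z < rho ->
  circle_mean rho k (fun u => u / (u - z)) * (1 - (z / toC rho) ^+ (2 ^ k)) = 1.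
Proof.
move=> r0 zr; have tr0 : toC rho != 0 by rewrite toC_eq0 gt_eqF.
set x := z / toC rho.
have x1 : cabs x < 1 by rewrite /x cabsM cabsV cabs_toC gtr0_norm// ltr_pdivrMr// mul1r.
have zE : z = x * toC rho by rewrite divfK.
clearbody x; rewrite /circle_mean -mulrA mulr_suml.
set w := om k; have w0 : w != 0 by exact: circ_neq0.
have wn : w ^+ (2 ^ k) = 1 by exact: om_pow.
have term (j : 'I_(2 ^ k)) : let u := toC rho * circ (j%:R / 2 ^+ k) in
    u / (u - z) * (1 - x ^+ (2 ^ k)) = \sum_(i < 2 ^ k) x ^+ i * (w ^- i) ^+ j.
  move=> u; have -> : u = toC rho * w ^+ j by rewrite /u /w /om circX.
  have wj0 : w ^+ j != 0 by rewrite expf_neq0.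
  pose y := x / w ^+ j.
  have y1 : cabs y < 1.
    by rewrite /y cabsM cabsV cabsX cabs_circ expr1n invr1 mulr1.
  have y0 : y - 1 != 0.
    by rewrite subr_eq0; apply/eqP => yE; move: y1; rewrite yE cabs1 ltxx.
  have -> : toC rho * w ^+ j / (toC rho * w ^+ j - z) = - (y - 1)^-1.
    have -> : toC rho * w ^+ j - z = - (toC rho * w ^+ j * (y - 1)).
      by rewrite zE /y; field.
    by field; rewrite y0 wj0 tr0.
  have -> : x ^+ (2 ^ k) = y ^+ (2 ^ k).
    by rewrite /y expr_div_n exprAC wn expr1n divr1.
  rewrite -[1 - _]opprB mulrNN subrX1 mulrA mulVf// mul1r.
  by apply: eq_bigr => i _; rewrite /y expr_div_n exprVn -!exprM mulnC.
under eq_bigr do rewrite term.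
rewrite exchange_big /= (bigD1 (Ordinal (expn_gt0 2 k : (0 < 2 ^ k)%N)))//=.
rewrite [X in _ + X]big1 => [|i i0].
  rewrite addr0; under eq_bigr do rewrite expr0 invr1 expr1n mulr1.
  by rewrite sumr_const card_ord mulVf// pnatr_eq0 expn_eq0.
rewrite -mulr_sumr.
have wi : w ^- i - 1 != 0.
  rewrite subr_eq0 invr_eq1 -(prim_order_dvd (om_primitive k)).
  by rewrite gtnNdvd// lt0n; move: i0; rewrite -val_eqE.
apply/eqP; rewrite mulf_eq0; apply/orP; right.
by rewrite -(mulrI_eq0 _ (mulfI wi)) -subrX1 exprVn exprAC wn expr1n invr1 subrr.
Qed.

End Circle.

(** * Cauchy's formula as a limit of finite means *)

Section CauchyMean.
Context {R : realType}.
Local Notation C := (Cplx R).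

Lemma derivableCM (f g : C -> C) z : derivable f z 1 -> derivable g z 1 ->
  derivable (fun y => f y * g y) z 1.
Proof. exact: derivableM. Qed.

Lemma derivableCV (f : C -> C) z : f z != 0 -> derivable f z 1 ->
  derivable (fun y => (f y)^-1) z 1.
Proof. exact: derivableV. Qed.

Lemma derivableCB (f g : C -> C) z : derivable f z 1 -> derivable g z 1 ->
  derivable (fun y => f y - g y) z 1.
Proof. exact: derivableB. Qed.

Lemma derivable_expn k (z : C) : derivable (fun y : C => y ^+ k) z 1.
Proof.
elim: k => [|k IH]; first exact: derivable_cst.
have -> : (fun y : C => y ^+ k.+1) = (fun y => y * y ^+ k).
  by apply/funext => y; rewrite exprS.
by apply: derivableCM IH; exact: derivable_id.
Qed.

Lemma derivable_horner (p : {poly C}) z : derivable (horner p) z 1.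
Proof.
elim/poly_ind: p => [|p c IH].
  have -> : horner (0 : {poly C}) = (fun=> 0) by apply/funext => y; rewrite horner0.
  exact: derivable_cst.
have -> : horner (p * 'X + c%:P) = (fun t : C => p.[t] * t - (- c)).
  by apply/funext => t; rewrite hornerMXaddC opprK.
apply: derivableCB (derivable_cst _ _ _); apply: derivableCM IH _.
exact: derivable_id.
Qed.

Lemma derivable_cabs_bound (g : C -> C) z : derivable g z 1 ->
  exists B d : R, 0 < d /\
    forall y, cabs (y - z) < d -> cabs (g y - g z) <= B * cabs (y - z).
Proof.
move=> /derivable_cabsP[c /(_ _ ltr01)[d d0 hd]].
exists (1 + cabs c), d; split => // y yz.
have -> : g y - g z = (g y - g z - c * (y - z)) + c * (y - z) by rewrite subrK.
by rewrite (le_trans (cabsD _ _))// mulrDl cabsM lerD2r hd.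
Qed.

(** Contract the circle towards z along z + sigma (u - z). Between sigma = 1 and
    sigma = de [boundary_sum_small] makes the difference of the two contour sums
    small; the contracted contour has length O(de) and h is bounded near z. *)
Lemma circle_trapezoid_small (rho : R) (z : C) (h : C -> C) :
  0 < rho -> cabs z < rho ->
  (forall u, u != z -> cabs u <= rho -> derivable h u 1) ->
  (exists B d : R, 0 < d /\ forall u, u != z -> cabs (u - z) < d -> cabs (h u) <= B) ->
  forall eta : R, 0 < eta -> exists k0, forall k, (k0 <= k)%N ->
    cabs (trapezoid h (fun t => toC rho * circ t) k 0 1) <= eta.
Proof.
move=> r0 zr hh [B [d [d0 hB]]] eta eta0.
pose gam t : C := toC rho * circ t.
have gamabs t : cabs (gam t) = rho by rewrite /gam cabsM cabs_circ mulr1 cabs_toC gtr0_norm.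
have gam_lip s t : cabs (gam s - gam t) <= rho * (4 * pi) * `|s - t|.
  by rewrite /gam -mulrBr cabsM cabs_toC gtr0_norm// -mulrA ler_pM2l// circ_lip.
have gam10 : gam 1 = gam 0 by rewrite /gam circ1 circ0.
rewrite -[X in trapezoid h X]/gam; clearbody gam.
have gamz t : gam t - z != 0.
  by rewrite subr_eq0; apply/eqP => gz; move: zr; rewrite -gz gamabs ltxx.
have gamz2 t : cabs (gam t - z) <= 2 * rho.
  by rewrite (le_trans (cabsB _ _))// gamabs mulr_natl mulr2n lerD2l ltW.
set Lam := rho * (4 * pi) in gam_lip.
have Lam0 : 0 < Lam by rewrite !mulr_gt0// pi_gt0.
pose B' := `|B| + 1.
have B'0 : 0 < B' by rewrite ltr_wpDl.
have [de [de0 de1 ded deB]] : exists de : R,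
    [/\ 0 < de, de <= 1, de * (2 * rho) < d & B' * (de * Lam) <= eta / 2].
  exists (Num.min 1 (Num.min (d / (2 * rho) / 2) (eta / 2 / (B' * Lam)))).
  have p1 : 0 < d / (2 * rho) / 2 by rewrite !divr_gt0// mulr_gt0.
  have p2 : 0 < eta / 2 / (B' * Lam) by rewrite !divr_gt0// mulr_gt0.
  set m := Num.min 1 _.
  have m0 : 0 < m by rewrite !lt_min ltr01 p1 p2.
  have m1 : m <= 1 by rewrite ge_min lexx.
  have m2 : m <= d / (2 * rho) / 2 by rewrite !ge_min lexx !orbT.
  have m3 : m <= eta / 2 / (B' * Lam) by rewrite !ge_min lexx !orbT.
  split => //.
    rewrite -ltr_pdivlMr ?mulr_gt0// (le_lt_trans m2)//.
    by rewrite gtr_pMr ?invf_lt1 ?ltr1n// divr_gt0 ?mulr_gt0.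
  by rewrite mulrCA -ler_pdivlMr// mulr_gt0.
pose Phi s t := z + toC (de + (1 - de) * s) * (gam t - z).
have sig s : 0 <= s <= 1 -> 0 < de + (1 - de) * s <= 1.
  move=> /andP[s0 s1]; apply/andP; split.
    by rewrite ltr_pwDl// mulr_ge0// subr_ge0.
  rewrite -lerBrDl; apply: (le_trans (ler_piMr _ s1)) => //.
  by rewrite subr_ge0.
have Phiz s t : 0 <= s <= 1 -> Phi s t != z.
  move=> /sig/andP[sg _]; rewrite -subr_eq0 /Phi addrC addKr mulf_neq0//.
  by rewrite toC_eq0 gt_eqF.
have Phiabs s t : 0 <= s <= 1 -> cabs (Phi s t) <= rho.
  move=> /sig/andP[]; rewrite /Phi; set c := de + _ => c0 c1.
  have -> : z + toC c * (gam t - z) = toC (1 - c) * z + toC c * gam t.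
    by rewrite toCB toC1; ring.
  rewrite (le_trans (cabsD _ _))// !cabsM gamabs !cabs_toC.
  rewrite !ger0_norm ?subr_ge0// ?(ltW c0)//.
  have := ler_wpM2l (_ : 0 <= 1 - c) (ltW zr); rewrite subr_ge0 => /(_ c1).
  lra.
have PhiL : exists2 Lam : R, 0 < Lam & forall s t s' t' : R,
  0 <= s <= 1 -> 0 <= s' <= 1 -> 0 <= t <= 1 -> 0 <= t' <= 1 ->
  cabs (Phi s t - Phi s' t') <= Lam * (`|s - s'| + `|t - t'|).
  exists (2 * rho + Lam) => [|s t s' t' sin s'in _ _].
    by rewrite addr_gt0// mulr_gt0.
  have /andP[c0 c1] := sig _ sin.
  have -> : Phi s t - Phi s' t' =
    toC ((1 - de) * (s - s')) * (gam t' - z) + toC (de + (1 - de) * s) * (gam t - gam t').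
    by rewrite /Phi !(toCD, toCM, toCB, toC1); ring.
  rewrite (le_trans (cabsD _ _))// !cabsM !cabs_toC normrM.
  rewrite (gtr0_norm c0) (ger0_norm (_ : 0 <= 1 - de)) ?subr_ge0//.
  have H1 : (1 - de) * `|s - s'| * cabs (gam t' - z) <= 2 * rho * `|s - s'|.
    rewrite mulrC ler_pM ?cabs_ge0 ?mulr_ge0 ?subr_ge0//.
    by rewrite ler_piMl// gerBl ltW.
  have H2 : (de + (1 - de) * s) * cabs (gam t - gam t') <= Lam * `|t - t'|.
    rewrite (le_trans _ (gam_lip _ _))// ler_piMl// cabs_ge0//.
  rewrite mulrDr (le_trans (lerD H1 H2))// !mulrDl lerD//.
    by rewrite lerDl mulr_ge0// ltW.
  by rewrite lerDr -mulrDl mulr_ge0// mul1r addr_ge0// ltW.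
have eta2 : 0 < eta / 2 by rewrite divr_gt0.
have [k0 hk] := @boundary_sum_small R h Phi PhiL
  (fun s t sin _ => hh _ (Phiz s t sin) (Phiabs s t sin)) _ eta2.
exists k0 => k /hk.
rewrite /boundary_sum !add0r.
have -> : (fun s => Phi s 1) = (fun s => Phi s 0).
  by apply/funext => s; rewrite /Phi gam10.
rewrite [X in X - _ - _]addrC addrK.
have -> : Phi 1 = gam.
  by apply/funext => t; rewrite /Phi mulr1 [de + _]addrC subrK toC1 mul1r addrC subrK.
move=> H; rewrite -[trapezoid _ _ _ _ _](subrK (trapezoid h (Phi 0) k 0 1)).
rewrite (le_trans (cabsD _ _))//.
have -> : eta = eta / 2 + eta / 2 by field.
apply: lerD => //; rewrite (le_trans _ deB)//.
have i0 : 0 <= (0 : R) <= 1 by rewrite lexx ler01.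
have Phi0 t : Phi 0 t - z = toC de * (gam t - z).
  by rewrite /Phi mulr0 addr0 addrC addKr.
rewrite -[leRHS]mulr1; apply: trapezoid_bound => //; first exact: ltW.
- move=> t _; have Hb : cabs (h (Phi 0 t)) <= B.
    apply: hB; first exact: Phiz.
    rewrite Phi0 cabsM cabs_toC gtr0_norm// (le_lt_trans _ ded)//.
    by rewrite ler_pM2l.
  by rewrite (le_trans Hb)// (le_trans (ler_norm _))// lerDl.
- move=> s t _ _.
  have -> : Phi 0 s - Phi 0 t = toC de * (gam s - gam t).
    by rewrite /Phi mulr0 addr0; ring.
  by rewrite cabsM cabs_toC gtr0_norm// -mulrA ler_pM2l.
Qed.

(** [circle_trapezoid_small] applies to the difference quotient of g at z, whose
    singularity is bounded; the mean of the kernel u / (u - z) is explicit. *)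
Lemma circle_mean_cauchy (rho : R) (z : C) (g : C -> C) :
  0 < rho -> cabs z < rho ->
  (forall u, cabs u <= rho -> derivable g u 1) ->
  forall eta : R, 0 < eta -> exists k0, forall k, (k0 <= k)%N ->
    cabs (circle_mean rho k (fun u => g u * (u / (u - z))) - g z) <= eta.
Proof.
move=> r0 zr hg eta eta0; have tr0 : toC rho != 0 by rewrite toC_eq0 gt_eqF.
pose h u := (g u - g z) * (u - z)^-1.
have hder u : u != z -> cabs u <= rho -> derivable h u 1.
  move=> uz ur; apply: derivableCM.
    by apply: derivableCB; [exact: hg|exact: derivable_cst].
  apply: derivableCV; first by rewrite subr_eq0.
  by apply: derivableCB; [exact: derivable_id|exact: derivable_cst].
have hbd : exists B d : R, 0 < d /\ forall u, u != z -> cabs (u - z) < d -> cabs (h u) <= B.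
  have [B [d [d0 hd]]] := derivable_cabs_bound _ _ (hg _ (ltW zr)).
  exists B, d; split => // u uz ud; rewrite /h cabsM cabsV ler_pdivrMr ?hd//.
  by rewrite cabs_gt0 subr_eq0.
have x1 : cabs (z / toC rho) < 1.
  by rewrite cabsM cabsV cabs_toC gtr0_norm// ltr_pdivrMr// mul1r.
have eta2 : 0 < eta / 2 by rewrite divr_gt0.
have [k1 hk1] := circle_trapezoid_small rho z h r0 zr hder hbd _ eta2.
pose B := cabs (g z) + 1.
have B0 : 0 < B by rewrite ltr_wpDl// cabs_ge0.
(* the n-point mean of the kernel is 1 / (1 - x ^ n), where x ^ n -> 0 *)
have [k2 hk2] : exists k2, forall k, (k2 <= k)%N ->
    cabs ((z / toC rho) ^+ (2 ^ k)) <= eta / 2 / (B + eta / 2).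
  have e0 : 0 < eta / 2 / (B + eta / 2) by rewrite divr_gt0// addr_gt0.
  have /cvgrPdist_lt /(_ _ e0)[k2 _ hk2] : (fun k => cabs (z / toC rho) ^+ k) @ \oo --> (0 : R).
    by apply: cvg_expr; rewrite ger0_norm// cabs_ge0.
  exists k2 => k k2k; rewrite cabsX ltW//.
  have := hk2 (2 ^ k)%N (leq_trans k2k (ltnW (ltn_expl _ (ltnSn 1)))) => /=.
  by rewrite sub0r normrN ger0_norm// exprn_ge0// cabs_ge0.
exists (k1 + k2).+2 => k lek.
have k1k : (k1 <= k)%N by lia.
have k2k : (k2 <= k)%N by lia.
have [k' kE] : exists k', k = k'.+2 by exists k.-2; lia.
move: (hk1 _ k1k) (hk2 _ k2k) => {hk1 hk2}.
rewrite trapezoid_circle; last by rewrite kE.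
set xn := (z / toC rho) ^+ _.
set M := circle_mean rho k (fun u => h u * u) => H1 H2.
have ME : M = circle_mean rho k (fun u => h u * u) by [].
clearbody M.
have MB : cabs M <= eta / 2.
  by rewrite (le_trans _ H1)// [leRHS]cabsM ler_peMl ?cabs_ge0// kE; exact: (chord_lb k').
have := circle_mean_kernel rho z k r0 zr; rewrite -/xn.
set W := circle_mean rho k _ => WE.
have WE0 : W = circle_mean rho k (fun u => u / (u - z)) by [].
clearbody W.
have -> : circle_mean rho k (fun u => g u * (u / (u - z))) = M + g z * W.
  rewrite ME WE0 /circle_mean [g z * _]mulrCA -mulrDr; congr (_ * _).
  rewrite mulr_sumr -big_split/=; apply: eq_bigr => j _; rewrite /h.
  by ring.
have B20 : 0 < B + eta / 2 by rewrite addr_gt0.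
have xn1 : cabs (1 - xn) >= B / (B + eta / 2).
  rewrite (le_trans _ (cabs_sub_ge _ _))// cabs1.
  have -> : B / (B + eta / 2) = 1 - eta / 2 / (B + eta / 2) by field; rewrite gt_eqF//; lra.
  by rewrite lerD2l lerN2.
have c0 : 0 < cabs (1 - xn) by rewrite (lt_le_trans _ xn1)// divr_gt0.
have -> : M + g z * W - g z = M + g z * xn * W.
  by rewrite -{2}[g z]mulr1 -WE; ring.
have -> : eta = eta / 2 + eta / 2 by field.
rewrite (le_trans (cabsD _ _))// lerD//.
have WE' : W = (1 - xn)^-1.
  by apply: (mulIf (_ : 1 - xn != 0)); rewrite ?WE ?mulVf// -cabs_gt0.
rewrite WE' !cabsM cabsV ler_pdivrMr//.
apply: (@le_trans _ _ (B * (eta / 2 / (B + eta / 2)))).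
  by rewrite ler_pM ?cabs_ge0// lerDl.
by rewrite mulrCA ler_pM2l.
Qed.

End CauchyMean.

(** * The Cauchy functional *)

Section CauchyFunctional.
Context {R : realType}.
Local Notation C := (Cplx R).

Lemma compact_rect (M : R) :
  compact ((fun p : R * R => Complex p.1 p.2 : C) @` (`[- M, M]%classic `*` `[- M, M]%classic)).
Proof.
apply: continuous_compact; last by apply: compact_setX; exact: segment_compact.
apply: continuous_subspaceT => -[x y]; apply/cvg_cabs => eta eta0.
have e2 : 0 < eta / 2 by rewrite divr_gt0.
exists (ball x (eta / 2), ball y (eta / 2)) => /=.
  by split; exact: nbhsx_ballx.
move=> -[s t] /= [xs yt].
change (cabs (Complex (s - x) (t - y) : C) < eta).
rewrite (le_lt_trans (cabs_Complex _ _))//.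
have -> : eta = eta / 2 + eta / 2 by field.
by rewrite ltrD// distrC.
Qed.

Lemma cabs_ge_Re (z : C) : `|complex.Re z| <= cabs z.
Proof. by rewrite -le_toC cabsE; exact: normc_ge_Re. Qed.

Lemma cabs_ge_Im (z : C) : `|complex.Im z| <= cabs z.
Proof.
case: z => x y; rewrite /cabs/= -sqrtr_sqr.
by apply: ler_wsqrtr; rewrite lerDr sqr_ge0.
Qed.

Lemma in_rect (M : R) (z : C) : cabs z <= M ->
  ((fun p : R * R => Complex p.1 p.2 : C) @` (`[- M, M]%classic `*` `[- M, M]%classic)) z.
Proof.
move=> zM; exists (complex.Re z, complex.Im z); last by case: z zM.
by split; rewrite /= in_itv /= -ler_norml (le_trans _ zM)// ?cabs_ge_Re ?cabs_ge_Im.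
Qed.

Lemma ultra_bounded_cvg (U : set_system nat) (u : nat -> C) (M : R) :
  UltraFilter U -> (forall k, cabs (u k) <= M) -> exists l : C, u @ U --> l.
Proof.
move=> UU uM; have [p [_ pcl]] := compact_rect M (u @ U) _
  (filterE _ (fun k => in_rect M _ (uM k))).
exists p => V Vp; have [UV|UV] := in_ultra_setVsetC (u @^-1` V) UU; first exact: UV.
by have [q [qV /qV]] := pcl (~` V) V UV Vp.
Qed.

Definition bounded_circle (rho : R) (h : C -> C) :=
  exists M : R, forall u, cabs u = rho -> cabs (h u) <= M.

Lemma circle_mean_le (rho : R) k h (M : R) : 0 <= rho ->
  (forall u, cabs u = rho -> cabs (h u) <= M) -> cabs (circle_mean rho k h) <= M.
Proof.
move=> r0 hM; have n0 : 0 < (2 ^ k)%:R :> R by rewrite ltr0n expn_gt0.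
rewrite /circle_mean cabsM cabsV cabs_nat mulrC ler_pdivrMr//.
rewrite (le_trans (cabs_sum _ _ _ _))//.
apply: (@le_trans _ _ (\sum_(j < 2 ^ k) M)).
  by apply: ler_sum => j _; apply: hM; rewrite cabsM cabs_circ mulr1 cabs_toC ger0_norm.
by rewrite sumr_const card_ord mulr_natr.
Qed.

(** The properties of the mean value of h over the circle of radius rho that are
    needed of an integral: boundedness, linearity, locality, Cauchy's formula. *)
Definition cauchy_mean (rho : R) (L : (C -> C) -> C) := [/\
    forall h (M : R), (forall u, cabs u = rho -> cabs (h u) <= M) -> cabs (L h) <= M,
    forall (c : C) (h1 h2 : C -> C), bounded_circle rho h1 -> bounded_circle rho h2 ->
      L (fun u => c * h1 u + h2 u) = c * L h1 + L h2,
    forall h1 h2 : C -> C, (forall u, cabs u = rho -> h1 u = h2 u) -> L h1 = L h2 &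
    forall (g : C -> C) z, (forall u, cabs u <= rho -> derivable g u 1) -> cabs z < rho ->
      L (fun u => g u * (u / (u - z))) = g z].

(** The means over the 2 ^ k-th roots of unity of a bounded function have a limit
    along any ultrafilter, which makes L linear on all bounded functions;
    [circle_mean_cauchy] identifies the limits that matter. *)
Lemma cauchy_functional (rho : R) : 0 < rho -> exists L, cauchy_mean rho L.
Proof.
move=> r0; have [U [UU sU]] := @ultraFilterLemma nat \oo _.
pose L h : C := lim (circle_mean rho ^~ h @ U).
have Lcvg h : bounded_circle rho h -> circle_mean rho ^~ h @ U --> L h.
  move=> [M hM]; have [|l hl] := @ultra_bounded_cvg U (circle_mean rho ^~ h) M UU.
    by move=> k; apply: circle_mean_le => //; exact: ltW.
  by rewrite /L (cvg_lim _ hl).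
have Luniq h l : circle_mean rho ^~ h @ U --> l -> L h = l by move=> hl; exact: cvg_lim.
exists L; split.
- move=> h M hM; have /Lcvg Lh : bounded_circle rho h by exists M.
  rewrite leNgt; apply/negP => ML.
  have /cvg_cabs /(_ (cabs (L h) - M)) := Lh; rewrite subr_gt0 => /(_ ML).
  move=> /filter_ex[k]; apply/negP; rewrite -leNgt.
  rewrite cabsBC (le_trans _ (cabs_sub_ge _ _))// lerD2l lerN2.
  by apply: circle_mean_le => //; exact: ltW.
- move=> c h1 h2 /Lcvg L1 /Lcvg L2; apply: Luniq.
  have -> : circle_mean rho ^~ (fun u => c * h1 u + h2 u) =
    (fun k => c * circle_mean rho k h1 + circle_mean rho k h2).
    apply/funext => k; rewrite /circle_mean mulrCA -mulrDr; congr (_ * _).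
    by rewrite mulr_sumr -big_split.
  apply: cvgD L2; apply: cvgM L1; exact: cvg_cst.
- move=> h1 h2 h12; congr (lim (_ @ U)); apply/funext => k; congr (_ * _).
  by apply: eq_bigr => j _; rewrite h12// cabsM cabs_circ mulr1 cabs_toC gtr0_norm.
- move=> g z hg zr; apply: Luniq; apply/cvg_cabs => eta eta0; apply: sU.
  have eta2 : 0 < eta / 2 by rewrite divr_gt0.
  have [k0 hk0] := @circle_mean_cauchy R rho z g r0 zr hg _ eta2.
  exists k0 => // k /= /hk0 /le_lt_trans; apply.
  by rewrite ltr_pdivrMr// ltr_pMr// ltr1n.
Qed.

End CauchyFunctional.

(** * Estimates for products, row vectors and polynomials *)

Lemma size_index_ord N : size (index_enum 'I_N) = N.
Proof. by rewrite [index_enum _]unlock -enumT size_enum_ord. Qed.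

Section Estimates.
Context {R : realType}.
Local Notation C := (Cplx R).

Lemma prod_le_expn (I : Type) (s : seq I) (F : I -> R) (B : R) :
  (forall i, 0 <= F i <= B) -> \prod_(i <- s) F i <= B ^+ size s.
Proof.
move=> FB; elim: s => [|i s IH]; first by rewrite big_nil.
have /andP[F0 FiB] := FB i.
rewrite big_cons exprS ler_pM//.
by apply: prodr_ge0 => j _; case/andP: (FB j).
Qed.

Lemma prod_dist (I : Type) (s : seq I) (F G : I -> C) (B d : R) : 1 <= B ->
  (forall i, cabs (F i) <= B) -> (forall i, cabs (G i) <= B) ->
  (forall i, cabs (F i - G i) <= d) ->
  cabs (\prod_(i <- s) F i - \prod_(i <- s) G i) <= (size s)%:R * B ^+ size s * d.
Proof.
move=> B1 FB GB FGd; have B0 : 0 <= B by rewrite (le_trans _ B1).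
elim: s => [|i s IH]; first by rewrite !big_nil subrr cabs0 !mul0r.
rewrite !big_cons.
have -> : F i * \prod_(j <- s) F j - G i * \prod_(j <- s) G j =
  F i * (\prod_(j <- s) F j - \prod_(j <- s) G j) + (F i - G i) * \prod_(j <- s) G j.
  by ring.
rewrite (le_trans (cabsD _ _))// !cabsM /= -natr1.
have d0 : 0 <= d by rewrite (le_trans (cabs_ge0 (F i - G i))).
have -> : ((size s)%:R + 1) * B ^+ (size s).+1 * d =
  B * ((size s)%:R * B ^+ size s * d) + d * B ^+ (size s).+1 by rewrite exprS; ring.
rewrite lerD// ler_pM ?cabs_ge0//.
rewrite cabs_prod (le_trans (prod_le_expn _ _ _ B _))// => [j|].
  by rewrite cabs_ge0 GB.
by rewrite exprS ler_peMl// exprn_ge0.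
Qed.

Lemma cabs_ge_half (q : C) (t : R) : cabs (q - 1) <= t -> t <= 1 / 2 -> 1 / 2 <= cabs q.
Proof. by have := cabs_sub_ge 1 (1 - q); rewrite subKr cabs1 cabsBC; lra. Qed.

Definition rnorm d (x : 'rV[C]_d) : R := \sum_k cabs (x 0 k).

Lemma rnorm_ge0 d (x : 'rV[C]_d) : 0 <= rnorm d x.
Proof. by apply: sumr_ge0 => k _; exact: cabs_ge0. Qed.

Lemma rnorm_eq0 d (x : 'rV[C]_d) : rnorm d x <= 0 -> x = 0.
Proof.
move=> x0; have : rnorm d x == 0 by rewrite eq_le x0 rnorm_ge0.
rewrite psumr_eq0 => [/allP x00|k _]; last exact: cabs_ge0.
apply/rowP => k; rewrite mxE; apply/eqP.
by rewrite -cabs_eq0; apply: x00; rewrite mem_index_enum.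
Qed.

Lemma rnormD d (x y : 'rV[C]_d) : rnorm d (x + y) <= rnorm d x + rnorm d y.
Proof.
by rewrite /rnorm -big_split; apply: ler_sum => k _; rewrite mxE cabsD.
Qed.

Lemma le_rnorm d (x : 'rV[C]_d) k : cabs (x 0 k) <= rnorm d x.
Proof.
by rewrite /rnorm (bigD1 k)//= lerDl sumr_ge0// => i _; exact: cabs_ge0.
Qed.

Lemma rnorm_mulmx d e (x : 'rV[C]_d) (A : 'M[C]_(d, e)) :
  rnorm e (x *m A) <= (\sum_i \sum_j cabs (A i j)) * rnorm d x.
Proof.
rewrite [rnorm e _]/rnorm exchange_big /= mulr_suml; apply: ler_sum => j _.
rewrite mxE (le_trans (cabs_sum _ _ _ _))// mulr_suml.
apply: ler_sum => i _; rewrite cabsM mulrC ler_wpM2l ?cabs_ge0//.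
exact: le_rnorm.
Qed.

Lemma row_linear_mx d e (g : 'rV[C]_d -> 'rV[C]_e) :
  (forall c x y, g (c *: x + y) = c *: g x + g y) ->
  exists A : 'M[C]_(d, e), forall x, g x = x *m A.
Proof.
move=> glin; pose gL : {linear 'rV[C]_d -> 'rV[C]_e} :=
  HB.pack g (GRing.isLinear.Build C _ _ _ g glin).
by exists (lin1_mx gL) => x; rewrite mul_rV_lin1.
Qed.

(** A matrix with trivial kernel has a right inverse, whose entries provide c. *)
Lemma injective_rnorm_bound d e (g : 'rV[C]_d -> 'rV[C]_e) :
  (forall c x y, g (c *: x + y) = c *: g x + g y) ->
  (forall x, g x = 0 -> x = 0) ->
  exists2 c : R, 0 <= c & forall x, rnorm d x <= c * rnorm e (g x).
Proof.
move=> /row_linear_mx[A gA] ginj.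
have /row_freeP[B AB] : row_free A.
  by apply: inj_row_free => v; rewrite -gA => /ginj.
exists (\sum_i \sum_j cabs (B i j)).
  by apply: sumr_ge0 => i _; apply: sumr_ge0 => j _; exact: cabs_ge0.
move=> x; rewrite -{1}[x]mulmx1 -AB mulmxA -gA; exact: rnorm_mulmx.
Qed.

Lemma row_linear_ker d e (g : 'rV[C]_d -> 'rV[C]_e) : (e < d)%N ->
  (forall c x y, g (c *: x + y) = c *: g x + g y) ->
  exists2 x, x != 0 & g x = 0.
Proof.
move=> ed /row_linear_mx[A gA].
have : kermx A != 0.
  rewrite -mxrank_eq0 mxrank_ker subn_eq0 -ltnNge.
  exact: leq_ltn_trans (rank_leq_col A) ed.
case/rowV0Pn => x /sub_kermxP xA x0; exists x => //; by rewrite gA.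
Qed.

Lemma poly_bounded (p : {poly C}) (r : R) : 1 <= r ->
  forall z, cabs z <= r -> cabs p.[z] <= (\sum_(i < size p) cabs p`_i) * r ^+ size p.
Proof.
move=> r1 z zr; rewrite horner_coef (le_trans (cabs_sum _ _ _ _))// mulr_suml.
apply: ler_sum => i _; rewrite cabsM cabsX ler_wpM2l ?cabs_ge0//.
have r0 : 0 <= r by rewrite (le_trans ler01).
apply: (@le_trans _ _ (r ^+ i)).
  by apply: lerXn2r => //; rewrite nnegrE cabs_ge0.
by rewrite ler_weXn2l// ltnW.
Qed.

Lemma le_small_eq0 (c B d : R) : 0 < d -> 
  (forall t, 0 < t < d -> c <= B * t) -> c <= 0.
Proof.
move=> d0 cB; rewrite leNgt; apply/negP => c0.
have B0 : 0 < `|B| + 1 by rewrite ltr_wpDl.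
pose t := Num.min (d / 2) (c / (`|B| + 1) / 2).
have t0 : 0 < t by rewrite lt_min !divr_gt0.
have td : t < d.
  by rewrite (le_lt_trans (_ : t <= d / 2)) ?ge_min ?lexx// gtr_pMr// invf_lt1// ltr1n.
have tc : (`|B| + 1) * t < c.
  rewrite mulrC -ltr_pdivlMr// (le_lt_trans (_ : t <= c / (`|B| + 1) / 2)) ?ge_min ?lexx ?orbT//.
  by rewrite gtr_pMr ?invf_lt1 ?ltr1n// divr_gt0.
have := cB t; rewrite t0 td => /(_ isT); apply/negP; rewrite -ltNge (le_lt_trans _ tc)//.
by rewrite ler_wpM2r ?(ltW t0)// (le_trans (ler_norm _))// lerDl.
Qed.

(** The value at 0 is O(|z|), hence 0; divide by the variable and induct on N. *)
Lemma poly_eq0_small N (p : {poly C}) (B d : R) : 0 < d -> (size p <= N)%N ->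
  (forall z, z != 0 -> cabs z < d -> cabs p.[z] <= B * cabs z ^+ N) -> p = 0.
Proof.
elim: N p => [|N IH] p d0 sp pB; first by apply/eqP; rewrite -size_poly_leq0.
pose d1 := Num.min d 1.
have d10 : 0 < d1 by rewrite lt_min d0 ltr01.
have p0 : p.[0] = 0.
  apply/eqP; rewrite -cabs_eq0 eq_le cabs_ge0 andbT.
  have /factor_theorem[q qE] : root (p - (p.[0])%:P) 0 by rewrite rootE !hornerE subrr.
  pose Bq := (\sum_(i < size q) cabs q`_i) * 1 ^+ size q.
  apply: (@le_small_eq0 _ (`|B| + Bq) d1) => // t /andP[t0].
  rewrite lt_min => /andP[td t1].
  have tC : toC t != 0 by rewrite toC_eq0 gt_eqF.
  have at_ : cabs (toC t : C) = t by rewrite cabs_toC gtr0_norm.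
  have := pB (toC t) tC; rewrite at_ => /(_ td) ptB.
  have -> : p.[0] = p.[toC t] - q.[toC t] * toC t.
    have := congr1 (horner^~ (toC t)) qE; rewrite !hornerE subr0 => <-.
    by rewrite opprB addrCA subrr addr0.
  rewrite (le_trans (cabsB _ _))// mulrDl lerD//.
    rewrite (le_trans ptB)// (le_trans (_ : _ <= `|B| * t ^+ N.+1))//.
      by rewrite ler_wpM2r ?ler_norm// exprn_ge0// ltW.
    by rewrite ler_wpM2l// exprS ler_piMr ?exprn_ile1 ?(ltW t0) ?(ltW t1).
  rewrite cabsM at_ ler_wpM2r ?(ltW t0)//.
  by apply: poly_bounded => //; rewrite at_ ltW.
have /factor_theorem[q qE] : root p 0 by rewrite rootE p0.
rewrite subr0 in qE.
suff q0 : q = 0 by rewrite qE q0 mul0r.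
apply: IH => //.
  have [->|q0] := eqVneq q 0; first by rewrite size_poly0.
  by move: sp; rewrite qE size_mulX.
move=> z z0 zd; have := pB z z0 zd.
rewrite qE hornerM hornerX cabsM exprSr mulrA ler_pM2r ?cabs_gt0//.
Qed.

End Estimates.

(** * Values and degeneracy of rational functions *)

Section RatfunValues.
Context {R : realType}.
Local Notation C := (Cplx R).
Implicit Types (p q : {poly C}).

Lemma tofrac_div_eq p q p' q' : q != 0 -> q' != 0 ->
  FracField.tofrac p / FracField.tofrac q = FracField.tofrac p' / FracField.tofrac q' ->
  p * q' = p' * q.
Proof.
move=> q0 q'0 /eqP; rewrite eqr_div ?tofrac_eq0//.
by rewrite -!rmorphM tofrac_eq => /eqP.
Qed.

(** The reduced denominator divides q, being coprime to the reduced numerator. *)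
Lemma rf_eval_frac p q (r : ratfun R) (z : C) : q.[z] != 0 ->
  r = FracField.tofrac p / FracField.tofrac q ->
  ~~ rf_pole r z /\ rf_eval r z = p.[z] / q.[z].
Proof.
move=> qz rE; have q0 : q != 0 by apply: contraNneq qz => ->; rewrite horner0.
have E : rf_num r * q = p * rf_den r.
  by apply: tofrac_div_eq => //; [exact: rf_den_neq0|rewrite -rf_num_den].
have dq : rf_den r %| q.
  have cop : coprimep (rf_den r) (rf_num r) by rewrite coprimep_sym coprimep_rf.
  by rewrite -(Gauss_dvdpr _ cop) E dvdp_mull.
have dz : (rf_den r).[z] != 0.
  by apply: contraNneq qz => dz0; rewrite -(divpK dq) hornerM dz0 mulr0.
split=> //; rewrite /rf_eval; apply/eqP; rewrite eqr_div//.
by have := congr1 (horner^~ z) E; rewrite !hornerM => ->.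
Qed.

Lemma deg_le_nat p (k : nat) : deg_le p k%:Z = (size p <= k.+1)%N.
Proof.
rewrite /deg_le -[(k%:Z + 1)]/(k%:Z + 1%:Z) -PoszD lez_nat addn1.
by case: eqVneq => // ->; rewrite size_poly0.
Qed.

(** If both p and q vanished at 0, cancelling the variable would lower both degrees. *)
Lemma nondegenerate_at0 (m n : nat) (r : ratfun R) p q :
  nondegenerate_rf m n r -> q != 0 -> deg_le p m%:Z -> deg_le q n%:Z ->
  r = FracField.tofrac p / FracField.tofrac q -> p.[0] = 0 -> q.[0] = 0 -> False.
Proof.
move=> [_ nd] q0 pm qn rE /eqP p00 /eqP q00; suff : (1 <= 0)%N by [].
apply: nd.
have /factor_theorem[p1] : root p 0 by [].
have /factor_theorem[q1] : root q 0 by [].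
rewrite subr0 => qE pE.
have q10 : q1 != 0 by apply: contraNneq q0 => q10; rewrite qE q10 mul0r.
have red (s s1 : {poly C}) (k : nat) : s = s1 * 'X -> deg_le s k%:Z -> deg_le s1 (k%:Z - 1%:Z).
  move=> ->; rewrite deg_le_nat /deg_le subrK.
  by have [//|s0] := eqVneq s1 0; rewrite size_mulX.
exists p1, q1; split => //; [exact: red pm|exact: red qn|].
rewrite rE pE qE !rmorphM /= -mulf_div divff ?mulr1//.
by rewrite tofrac_eq0 polyX_eq0.
Qed.

End RatfunValues.

(** * Newton remainders as Cauchy transforms *)

Section Functional.
Context {R : realType}.
Local Notation C := (Cplx R).

Variables (rho : R) (L : (C -> C) -> C).
Hypotheses (rho0 : 0 < rho) (cL : cauchy_mean rho L).
Local Notation bounded := (bounded_circle rho).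

Lemma boundedD h1 h2 : bounded h1 -> bounded h2 -> bounded (fun u => h1 u + h2 u).
Proof.
move=> [M1 H1] [M2 H2]; exists (M1 + M2) => u ur.
by rewrite (le_trans (cabsD _ _))// lerD ?H1 ?H2.
Qed.

Lemma boundedM h1 h2 : bounded h1 -> bounded h2 -> bounded (fun u => h1 u * h2 u).
Proof.
move=> [M1 H1] [M2 H2]; exists (M1 * M2) => u ur.
by rewrite cabsM ler_pM ?cabs_ge0 ?H1 ?H2.
Qed.

Lemma bounded_cst c : bounded (fun=> c).
Proof. by exists (cabs c). Qed.

Lemma bounded_exp k : bounded (fun u => u ^+ k).
Proof. by exists (rho ^+ k) => u <-; rewrite cabsX. Qed.

Lemma bounded_id : bounded (fun u => u).
Proof. by exists rho => u ->. Qed.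

Lemma circle_dist_ge z u : cabs u = rho -> rho - cabs z <= cabs (u - z).
Proof. by move=> <-; exact: cabs_sub_ge. Qed.

Lemma circle_sub_neq0 z u : cabs z < rho -> cabs u = rho -> u - z != 0.
Proof.
move=> zr ur; rewrite -cabs_gt0 (lt_le_trans _ (circle_dist_ge z u ur))//.
by rewrite subr_gt0.
Qed.

Lemma cabs_kernel_le z u : cabs z < rho -> cabs u = rho ->
  cabs (u - z)^-1 <= (rho - cabs z)^-1.
Proof.
move=> zr ur; rewrite cabsV lef_pV2 ?posrE ?subr_gt0 ?circle_dist_ge//.
by rewrite cabs_gt0 circle_sub_neq0.
Qed.

Lemma bounded_kernel z : cabs z < rho -> bounded (fun u => (u - z)^-1).
Proof. by move=> zr; exists (rho - cabs z)^-1 => u; exact: cabs_kernel_le. Qed.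

Lemma bounded_prod_kernel (I : Type) (s : seq I) (w : I -> C) :
  (forall i, cabs (w i) < rho) -> bounded (fun u => \prod_(i <- s) (u - w i)^-1).
Proof.
move=> wr; elim: s => [|i s IH].
  by exists 1 => u _; rewrite big_nil cabs1.
have [M HM] := boundedM _ _ (bounded_kernel _ (wr i)) IH.
by exists M => u ur; rewrite big_cons HM.
Qed.

Lemma L_zero : L (fun=> 0) = 0.
Proof.
case: cL => Lb _ _ _; apply/eqP; rewrite -cabs_eq0 eq_le cabs_ge0 andbT.
by apply: Lb => u _; rewrite cabs0.
Qed.

Lemma L_scale c h : bounded h -> L (fun u => c * h u) = c * L h.
Proof.
case: cL => _ Ll Le _ hb.
rewrite -[RHS]addr0 -L_zero -Ll//; last by exists 0 => u _; rewrite cabs0.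
by apply: Le => u _; rewrite addr0.
Qed.

Lemma L_sub h1 h2 : bounded h1 -> bounded h2 -> L (fun u => h1 u - h2 u) = L h1 - L h2.
Proof.
case: cL => _ Ll Le _ b1 b2; rewrite addrC -mulN1r -Ll//.
by apply: Le => u _; rewrite mulN1r addrC.
Qed.

Lemma L_sum k (c : 'I_k -> C) (h : 'I_k -> C -> C) : (forall i, bounded (h i)) ->
  L (fun u => \sum_i c i * h i u) = \sum_i c i * L (h i).
Proof.
case: cL => _ Ll Le _; elim: k c h => [|k IH] c h hb.
  by rewrite big_ord0 -[RHS]L_zero; apply: Le => u _; rewrite big_ord0.
rewrite big_ord_recl -(IH (fun i => c (lift ord0 i)) (fun i => h (lift ord0 i)))//.
rewrite -Ll//.
  by apply: Le => u _; rewrite big_ord_recl.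
have : forall k' (c' : 'I_k' -> C) (h' : 'I_k' -> C -> C), (forall i, bounded (h' i)) ->
    bounded (fun u => \sum_i c' i * h' i u).
  elim=> [|k' IHk] c' h' hb'; first by exists 0 => u _; rewrite big_ord0 cabs0.
  have [M HM] := boundedD _ _ (boundedM _ _ (bounded_cst (c' ord0)) (hb' ord0))
    (IHk (fun i => c' (lift ord0 i)) (fun i => h' (lift ord0 i)) (fun i => hb' _)).
  by exists M => u ur; rewrite big_ord_recl HM.
by apply.
Qed.

(** Cauchy transforms of arbitrary bounded functions are holomorphic: this is
    what removes the singularities of divided differences. The first-order
    remainder of 1 / (u - y) at y = z is O(|y - z| ^ 2) uniformly on the circle. *)
Lemma cauchy_transform_derivable h z : bounded h -> cabs z < rho ->
  derivable (fun y => L (fun u => h u / (u - y))) z 1.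
Proof.
move=> hb zr; case: (cL) => Lb Ll Le _; apply/derivable_cabsP.
exists (L (fun u => h u / (u - z) / (u - z))) => eta eta0.
have [M HM] := hb.
pose s := rho - cabs z; have s0 : 0 < s by rewrite subr_gt0.
have s20 : 0 < s / 2 by rewrite divr_gt0.
pose B := (`|M| + 1) * s^-1 * s^-1 * (s / 2)^-1.
have B0 : 0 < B by rewrite !mulr_gt0 ?invr_gt0// ltr_wpDl.
exists (Num.min (s / 2) (eta / B)); first by rewrite lt_min s20 divr_gt0.
move=> y; rewrite lt_min => /andP[ys yB].
have ysE : s / 2 <= rho - cabs y.
  have -> : cabs y = cabs (z + (y - z)) by rewrite addrC subrK.
  have := cabsD z (y - z); move: (ltW ys); rewrite /s; lra.
have yr : cabs y < rho by rewrite -subr_gt0 (lt_le_trans s20).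
have bk := bounded_kernel _ zr; have bky := bounded_kernel _ yr.
have b1 := boundedM _ _ hb bky; have b2 := boundedM _ _ hb bk.
have b3 := boundedM _ _ b2 bk.
have b12 : bounded (fun u => h u / (u - y) - h u / (u - z)).
  have [M' HM'] := boundedD _ _ b1 (boundedM _ _ (bounded_cst (-1)) b2).
  by exists M' => u ur; move: (HM' u ur); rewrite mulN1r.
rewrite -(L_sub _ _ b1 b2) [L _ * _]mulrC -(L_scale (y - z) _ b3).
rewrite -(L_sub _ _ b12 (boundedM _ _ (bounded_cst _) b3)).
apply: (@le_trans _ _ (B * cabs (y - z) * cabs (y - z))); last first.
  by rewrite ler_wpM2r ?cabs_ge0// mulrC -ler_pdivlMr// ltW.
apply: Lb => u ur.
have uz : u - z != 0 by exact: circle_sub_neq0.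
have uy : u - y != 0 by exact: circle_sub_neq0.
have -> : h u / (u - y) - h u / (u - z) - (y - z) * (h u / (u - z) / (u - z)) =
  h u * (u - z)^-1 * (u - z)^-1 * (u - y)^-1 * (y - z) * (y - z).
  by field; rewrite uz uy.
rewrite 5!cabsM !ler_pM ?mulr_ge0 ?cabs_ge0//.
- by rewrite (le_trans (HM _ ur))// (le_trans (ler_norm _))// lerDl.
- exact: cabs_kernel_le.
- exact: cabs_kernel_le.
- rewrite (le_trans (cabs_kernel_le _ _ yr ur))// lef_pV2 ?posrE//.
  by rewrite subr_gt0.
Qed.

Section Remainder.
Variables (N : nat) (w : 'I_N -> C).
Hypothesis wr : forall j, cabs (w j) < rho.

Definition inv_omega (u : C) : C := \prod_j (u - w j)^-1.

Lemma bounded_inv_omega : bounded inv_omega.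
Proof. exact: bounded_prod_kernel. Qed.

Lemma inv_omegaK u : (forall j, u - w j != 0) -> inv_omega u * \prod_j (u - w j) = 1.
Proof. by move=> uw; rewrite -big_split big1// => j _; rewrite /= mulVf. Qed.

(** Write omega for the nodal polynomial. As omega(u) - omega(z) = G(u) (u - z)
    with deg G < N, Cauchy's formula for g splits into omega(z) times the Cauchy
    transform of g / omega and a combination of the N moments of g against
    u ^ (k + 1) / omega(u). *)
Lemma newton_remainder (g : C -> C) z :
  (forall u, cabs u <= rho -> derivable g u 1) -> bounded g -> cabs z < rho ->
  (forall k : 'I_N, L (fun u => g u * u ^+ k.+1 * inv_omega u) = 0) ->
  g z = L (fun u => g u * u * inv_omega u / (u - z)) * \prod_j (z - w j).
Proof.
move=> gd gb zr gk; case: (cL) => Lb Ll Le Lc.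
pose Om : {poly C} := \prod_j ('X - (w j)%:P).
have OmE u : Om.[u] = \prod_j (u - w j).
  by rewrite horner_prod; apply: eq_bigr => j _; rewrite hornerXsubC.
have /factor_theorem[G GE] : root (Om - (Om.[z])%:P) z.
  by rewrite rootE !hornerE subrr.
have sOm : size Om = N.+1 by rewrite size_prod_XsubC size_index_ord.
have sG : (size G <= N)%N.
  have [->|G0] := eqVneq G 0; first by rewrite size_poly0.
  have : (size (Om - (Om.[z])%:P)%R <= N.+1)%N.
    rewrite (leq_trans (size_polyD _ _))// size_polyN sOm geq_max leqnn.
    by rewrite (leq_trans (size_polyC_leq1 _)).
  by rewrite GE size_Mmonic ?monicXsubC// size_XsubC addn2.
have bk := bounded_kernel _ zr; have bo := bounded_inv_omega.
rewrite -{1}(Lc g z gd zr) mulrC -L_scale; last first.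
  by apply: boundedM => //; apply: boundedM => //; apply: boundedM => //; exact: bounded_id.
have bG (k : 'I_N) : bounded (fun u => g u * u ^+ k.+1 * inv_omega u).
  by apply: boundedM => //; apply: boundedM => //; exact: bounded_exp.
have -> : L (fun u => g u * (u / (u - z))) = L (fun u =>
    (\prod_j (z - w j)) * (g u * u * inv_omega u / (u - z)) +
    \sum_(k < N) G`_k * (g u * u ^+ k.+1 * inv_omega u)).
  apply: Le => u ur.
  have uz : u - z != 0 by exact: circle_sub_neq0.
  have uw j : u - w j != 0 by exact: circle_sub_neq0.
  have -> : \sum_(k < N) G`_k * (g u * u ^+ k.+1 * inv_omega u) =
      g u * u * inv_omega u * G.[u].
    rewrite (horner_coef_wide _ sG) mulr_sumr; apply: eq_bigr => k _.
    by rewrite exprS; ring.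
  have := congr1 (horner^~ u) GE; rewrite !hornerE OmE.
  rewrite -!OmE => GuE.
  have Gu : G.[u] = (Om.[u] - Om.[z]) / (u - z) by rewrite GuE mulfK.
  have := inv_omegaK u uw; rewrite -[X in _ * X]OmE => io.
  rewrite -[LHS]mulr1 -[in LHS]io Gu !OmE; move: (inv_omega u) => io' /=.
  by field.
rewrite -[X in L (fun u => _ * _ + X u)]/(fun u => \sum_(k < N) G`_k * (g u * u ^+ k.+1 * inv_omega u)).
rewrite Ll.
- rewrite (L_sum N (fun k => G`_k) _ bG) [X in _ + X]big1 ?addr0 => [|k _]; last by rewrite gk mulr0.
  rewrite L_scale//; apply: boundedM => //; apply: boundedM => //.
  by apply: boundedM => //; exact: bounded_id.
- by apply: boundedM => //; apply: boundedM => //; apply: boundedM => //; exact: bounded_id.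
- exists (\sum_(k < N) cabs G`_k * projT1 (cid (bG k))) => u ur.
  rewrite (le_trans (cabs_sum _ _ _ _))//; apply: ler_sum => k _.
  by rewrite cabsM ler_wpM2l ?cabs_ge0//; case: (cid (bG k)) => M /= ->.
Qed.

(** For g = v omega the k-th moment is the value of v(u) u ^ (k + 1) at 0. *)
Lemma moments_of_multiple (g v : C -> C) :
  (forall u, cabs u <= rho -> derivable v u 1) ->
  (forall u, cabs u <= rho -> g u = v u * \prod_j (u - w j)) ->
  forall k : 'I_N, L (fun u => g u * u ^+ k.+1 * inv_omega u) = 0.
Proof.
move=> vd gE k; case: (cL) => Lb Ll Le Lc.
pose h u : C := v u * u ^+ k.+1.
have hd u : cabs u <= rho -> derivable h u 1.
  move=> ur; apply: derivableCM; first exact: vd.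
  exact: derivable_expn.
have := Lc h 0 hd; rewrite cabs0 => /(_ rho0); rewrite {2}/h exprS mul0r mulr0 => <-.
apply: Le => u ur; rewrite gE ?ur// subr0.
have uw j : u - w j != 0 by exact: circle_sub_neq0.
have u0 : u != 0 by rewrite -cabs_gt0 ur.
have io := inv_omegaK u uw.
rewrite divff// mulr1 /h -[RHS]mulr1 -[in RHS]io.
by move: (inv_omega u) (\prod_j _) (u ^+ _) => x y t; ring.
Qed.

End Remainder.
End Functional.

(** * The linearised interpolation problem *)

Section LinearizedSystem.
Context {R : realType}.
Local Notation C := (Cplx R).
Variables (rho : R) (L : (C -> C) -> C) (f : C -> C) (m n : nat).
Hypotheses (rho0 : 0 < rho) (rho1 : rho <= 1) (cL : cauchy_mean rho L).
Hypothesis fder : forall u, cabs u <= rho -> derivable f u 1.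
Hypothesis fbd : bounded_circle rho f.
Local Notation bounded := (bounded_circle rho).
Local Notation N := (m + n).+1.
Local Notation d := (m.+1 + n.+1)%N.

Implicit Types (x y : 'rV[C]_d) (w : 'I_N -> C).

(** A row vector holds the coefficients of a numerator followed by those of a
    denominator, so that p - q f depends linearly on it. *)
Definition numer (x : 'rV[C]_d) : {poly C} := rVpoly (lsubmx x).
Definition denom (x : 'rV[C]_d) : {poly C} := rVpoly (rsubmx x).
Definition denom0 (x : 'rV[C]_d) : C := x 0 (rshift m.+1 ord0).
Definition residual (x : 'rV[C]_d) (u : C) : C := (numer x).[u] - (denom x).[u] * f u.

Lemma numerD c x y : numer (c *: x + y) = c *: numer x + numer y.
Proof. by rewrite /numer !linearP. Qed.

Lemma denomD c x y : denom (c *: x + y) = c *: denom x + denom y.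
Proof. by rewrite /denom !linearP. Qed.

Lemma denom0D c x y : denom0 (c *: x + y) = c * denom0 x + denom0 y.
Proof. by rewrite /denom0 !mxE. Qed.

Lemma residualD c x y u : residual (c *: x + y) u = c * residual x u + residual y u.
Proof. by rewrite /residual numerD denomD !hornerD !hornerZ; ring. Qed.

Lemma denom_at0 x : (denom x).[0] = denom0 x.
Proof.
rewrite horner_coef0 /denom (coef_rVpoly_ord (rsubmx x) ord0).
by rewrite /denom0 mxE.
Qed.

Lemma rnorm_numer_denom x : rnorm d x = rnorm _ (lsubmx x) + rnorm _ (rsubmx x).
Proof.
by rewrite /rnorm big_split_ord; congr (_ + _); apply: eq_bigr => i _; rewrite mxE.
Qed.

Lemma rVpoly_horner k (v : 'rV[C]_k) u : (rVpoly v).[u] = \sum_(i < k) v 0 i * u ^+ i.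
Proof.
rewrite (@horner_coef_wide _ k) ?size_poly//.
by apply: eq_bigr => i _; rewrite coef_rVpoly_ord.
Qed.

Lemma rVpoly_le k (v : 'rV[C]_k) u : cabs u <= 1 -> cabs (rVpoly v).[u] <= rnorm k v.
Proof.
move=> u1; rewrite rVpoly_horner (le_trans (cabs_sum _ _ _ _))//.
by apply: ler_sum => i _; rewrite cabsM cabsX ler_piMr ?cabs_ge0// exprn_ile1// cabs_ge0.
Qed.

Lemma numer_le x u : cabs u <= 1 -> cabs (numer x).[u] <= rnorm d x.
Proof.
by move=> u1; rewrite (le_trans (rVpoly_le _ _ _ u1))// rnorm_numer_denom lerDl rnorm_ge0.
Qed.

Lemma denom_le x u : cabs u <= 1 -> cabs (denom x).[u] <= rnorm d x.
Proof.
by move=> u1; rewrite (le_trans (rVpoly_le _ _ _ u1))// rnorm_numer_denom lerDr rnorm_ge0.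
Qed.

Lemma denom_sub_le x u : cabs u <= 1 -> cabs ((denom x).[u] - denom0 x) <= rnorm d x * cabs u.
Proof.
move=> u1; rewrite /denom rVpoly_horner big_ord_recl expr0 mulr1.
have -> : rsubmx x 0 ord0 = denom0 x by rewrite /denom0 mxE.
rewrite [X in X - _]addrC addrK (le_trans (cabs_sum _ _ _ _))//.
apply: (@le_trans _ _ (rnorm _ (rsubmx x) * cabs u)); last first.
  by rewrite ler_wpM2r ?cabs_ge0// rnorm_numer_denom lerDr rnorm_ge0.
rewrite /rnorm big_ord_recl mulrDl mulr_suml.
apply: (@le_trans _ _ (\sum_(i < n) cabs (rsubmx x 0 (lift ord0 i)) * cabs u)).
  apply: ler_sum => i _; rewrite cabsM cabsX ler_wpM2l ?cabs_ge0//.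
  by rewrite exprS ler_piMr ?cabs_ge0// exprn_ile1// cabs_ge0.
by rewrite lerDr mulr_ge0 ?cabs_ge0.
Qed.

Lemma size_numer x : (size (numer x) <= m.+1)%N. Proof. exact: size_poly. Qed.
Lemma size_denom x : (size (denom x) <= n.+1)%N. Proof. exact: size_poly. Qed.

Lemma numer_denom_inj x : numer x = 0 -> denom x = 0 -> x = 0.
Proof.
move=> nx dx; rewrite -[x]hsubmxK -[lsubmx x]rVpolyK -[rsubmx x]rVpolyK.
by rewrite -/(numer x) -/(denom x) nx dx !linear0 row_mx0.
Qed.

Lemma numer_denom_surj (p q : {poly C}) : (size p <= m.+1)%N -> (size q <= n.+1)%N ->
  exists x, numer x = p /\ denom x = q.
Proof.
move=> sp sq; exists (row_mx (poly_rV p) (poly_rV q)).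
by rewrite /numer /denom row_mxKl row_mxKr !poly_rV_K.
Qed.

Lemma residual_derivable x u : cabs u <= rho -> derivable (residual x) u 1.
Proof.
move=> ur; apply: derivableCB (derivable_horner _ _) _.
by apply: derivableCM (derivable_horner _ _) _; exact: fder.
Qed.

Lemma residual_le : exists2 M : R, 0 < M &
  forall x u, cabs u = rho -> cabs (residual x u) <= M * rnorm d x.
Proof.
have [Mf HMf] := fbd; exists (1 + `|Mf|); first by rewrite ltr_pwDl.
move=> x u ur; have u1 : cabs u <= 1 by rewrite ur.
rewrite (le_trans (cabsB _ _))// mulrDl mul1r lerD ?numer_le//.
rewrite cabsM mulrC ler_pM ?cabs_ge0 ?denom_le//.
by rewrite (le_trans (HMf u ur))// ler_norm.
Qed.

Lemma bounded_residual x : bounded (residual x).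
Proof. by have [M _ HM] := residual_le; exists (M * rnorm d x) => u; exact: HM. Qed.

(** Their vanishing is equivalent to divisibility of the residual by the nodal
    polynomial ([moments0_eq0P], [moments_eq0]), with quotient [quotient]. Unlike
    divided differences they depend on the nodes through 1 / omega on the circle
    only, and so vary smoothly even where nodes collide. *)
Definition moments (w : 'I_N -> C) (x : 'rV[C]_d) : 'rV[C]_N :=
  \row_(k < N) L (fun u => residual x u * u ^+ k.+1 * inv_omega N w u).

Definition quotient (w : 'I_N -> C) (x : 'rV[C]_d) (z : C) : C :=
  L (fun u => residual x u * u * inv_omega N w u / (u - z)).

Lemma bounded_moment w x k : (forall j, cabs (w j) < rho) ->
  bounded (fun u => residual x u * u ^+ k * inv_omega N w u).
Proof.
move=> wr; apply: boundedM; last exact: bounded_inv_omega.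
by apply: boundedM; [exact: bounded_residual|exact: bounded_exp].
Qed.

Lemma momentsD w c x y : (forall j, cabs (w j) < rho) ->
  moments w (c *: x + y) = c *: moments w x + moments w y.
Proof.
move=> wr; apply/rowP => k; rewrite !mxE.
case: (cL) => _ Ll Le _; rewrite -Ll; try exact: bounded_moment.
by apply: Le => u _; rewrite residualD; ring.
Qed.

Lemma moments0_eq0P w x : (forall j, cabs (w j) < rho) -> moments w x = 0 ->
  forall z, cabs z < rho -> residual x z = quotient w x z * \prod_j (z - w j).
Proof.
move=> wr mx0 z zr.
have mk (k : 'I_N) : L (fun u => residual x u * u ^+ k.+1 * inv_omega N w u) = 0.
  by have := congr1 (fun v : 'rV_N => v 0 k) mx0; rewrite !mxE.
have := newton_remainder rho L cL N w wr (residual x) z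
  (fun u ur => residual_derivable x u ur) (bounded_residual x) zr mk.
by rewrite /quotient.
Qed.

Lemma moments_eq0 w x (v : C -> C) : (forall j, cabs (w j) < rho) ->
  (forall u, cabs u <= rho -> derivable v u 1) ->
  (forall u, cabs u <= rho -> residual x u = v u * \prod_j (u - w j)) ->
  moments w x = 0.
Proof.
move=> wr vd xE; apply/rowP => k; rewrite !mxE.
exact: (moments_of_multiple rho L rho0 cL N w wr _ v vd xE).
Qed.

Lemma quotient_derivable w x z : (forall j, cabs (w j) < rho) -> cabs z < rho ->
  derivable (quotient w x) z 1.
Proof.
move=> wr zr; rewrite /quotient.
have := cauchy_transform_derivable rho L cL _ z (bounded_moment w x 1 wr) zr.
by under eq_fun do under eq_fun do rewrite expr1.
Qed.

(** There are m + n + 2 unknowns and only m + n + 1 moments. *)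
Lemma moments_ker w : (forall j, cabs (w j) < rho) ->
  exists2 x, x != 0 & moments w x = 0.
Proof.
move=> wr; apply: row_linear_ker => [|c x y]; last exact: momentsD.
by rewrite addSn addnS.
Qed.

Local Notation origin := (fun _ : 'I_N => 0 : C).

Lemma origin_small (j : 'I_N) : cabs (origin j) < rho.
Proof. by rewrite cabs0. Qed.

(** On the circle the factors 1 / (u - w j) and 1 / u are at most 2 / rho and differ
    by at most (2 / rho) ^ 2 s. *)
Lemma inv_omega_lip : exists2 K : R, 0 < K & forall w (s : R),
  s <= rho / 2 -> (forall j, cabs (w j) <= s) -> forall u, cabs u = rho ->
  cabs (inv_omega N w u) <= K /\ cabs (inv_omega N w u - inv_omega N origin u) <= K * s.
Proof.
have B1 : 1 <= 2 / rho by rewrite ler_pdivlMr// mul1r (le_trans rho1)// ler1n.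
pose K := N%:R * (2 / rho) ^+ N * (2 / rho) ^+ 2.
have E0 : 0 <= 2 / rho := le_trans ler01 B1.
have KN : (2 / rho) ^+ N <= K.
  rewrite /K mulrAC ler_peMl ?exprn_ge0//.
  by rewrite mulr_ege1 ?exprn_ege1// ler1n.
exists K; first by rewrite (lt_le_trans _ KN)// exprn_gt0// divr_gt0.
move=> w s sr ws u ur.
have wr j : cabs (w j) < rho.
  by rewrite (le_lt_trans (ws j))// (le_lt_trans sr)// gtr_pMr// invf_lt1// ltr1n.
have kw j : cabs (u - w j)^-1 <= 2 / rho.
  rewrite (le_trans (cabs_kernel_le rho _ _ (wr j) ur))//.
  rewrite -[2 / rho]invrK invf_div lef_pV2 ?posrE ?subr_gt0 ?divr_gt0//.
  have := ws j; lra.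
have k0 j : cabs (u - origin j)^-1 <= 2 / rho.
  rewrite subr0 cabsV ur ler_pdivlMr// mulVf ?gt_eqF// ler1n//.
have sz := size_index_ord N.
split.
  rewrite (le_trans _ KN)// /inv_omega cabs_prod -[X in _ ^+ X]sz.
  by apply: prod_le_expn => j; rewrite cabs_ge0 kw.
have := @prod_dist R _ (index_enum 'I_N) (fun j => (u - w j)^-1)
  (fun j => (u - origin j)^-1) (2 / rho) ((2 / rho) ^+ 2 * s) B1 kw k0.
rewrite sz mulrA; apply => j.
have uw : u - w j != 0 by exact: (circle_sub_neq0 rho).
have u0 : u - 0 != 0 by rewrite subr0 -cabs_gt0 ur.
have -> : (u - w j)^-1 - (u - 0)^-1 = (u - w j)^-1 * (u - 0)^-1 * w j.
  by rewrite subr0 in u0 *; field; rewrite u0.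
rewrite !cabsM ler_pM ?mulr_ge0 ?cabs_ge0// expr2 ler_pM ?cabs_ge0//.
exact: (k0 j).
Qed.

Lemma moments_lip : exists2 K : R, 0 < K & forall w (s : R),
  s <= rho / 2 -> (forall j, cabs (w j) <= s) -> forall x,
  rnorm N (moments w x - moments origin x) <= K * s * rnorm d x.
Proof.
have [K K0 HK] := inv_omega_lip; have [M M0 HM] := residual_le.
exists (N%:R * (M * K)); first by rewrite !mulr_gt0// ltr0n.
move=> w s sr ws x.
have wr j : cabs (w j) < rho.
  by rewrite (le_lt_trans (ws j))// (le_lt_trans sr)// gtr_pMr// invf_lt1// ltr1n.
rewrite /rnorm (le_trans (_ : _ <= \sum_(k < N) M * K * s * rnorm d x))//; last first.
  by rewrite sumr_const card_ord -[leLHS]mulr_natl !mulrA.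
apply: ler_sum => k _; rewrite !mxE -(L_sub rho L cL); try exact: bounded_moment.
  case: (cL) => Lb _ _ _; apply: Lb => u ur.
  rewrite -mulrBr !cabsM cabsX ur.
  have -> : M * K * s * rnorm d x = M * rnorm d x * (K * s) by ring.
  have [_ HKs] := HK w s sr ws u ur.
  have rk0 : 0 <= rho ^+ k.+1 by rewrite exprn_ge0// ltW.
  have rk1 : rho ^+ k.+1 <= 1 by rewrite exprn_ile1// ltW.
  rewrite ler_pM ?mulr_ge0 ?cabs_ge0//.
  by rewrite (le_trans _ (HM x u ur))// ler_piMr// cabs_ge0.
by apply: bounded_moment; exact: origin_small.
Qed.

Lemma quotient_lip : exists2 K : R, 0 < K & forall w (s : R),
  s <= rho / 2 -> (forall j, cabs (w j) <= s) -> forall x z, cabs z <= s ->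
  cabs (quotient w x z - quotient origin x 0) <= K * s * rnorm d x.
Proof.
have [K K0 HK] := inv_omega_lip; have [M M0 HM] := residual_le.
have r2 : 0 < 2 / rho by rewrite divr_gt0.
exists (M * (2 * K * (2 / rho) ^+ 2)).
  by apply: mulr_gt0 => //; apply: mulr_gt0; [apply: mulr_gt0|exact: exprn_gt0].
move=> w s sr ws x z zs.
have s0 : 0 <= s by rewrite (le_trans _ zs)// cabs_ge0.
have srho : s < rho by rewrite (le_lt_trans sr)// gtr_pMr// invf_lt1// ltr1n.
have wr j : cabs (w j) < rho by rewrite (le_lt_trans (ws j)).
have zr : cabs z < rho by rewrite (le_lt_trans zs).
have b1 := boundedM rho _ _ (bounded_moment w x 1 wr) (bounded_kernel rho z zr).
have b0 := boundedM rho _ _ (bounded_moment origin x 1 origin_small) (bounded_kernel rho 0 (origin_small ord0)).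
rewrite /quotient -(L_sub rho L cL _ _ b1 b0).
case: (cL) => Lb _ _ _; apply: Lb => u ur.
have [_ H2] := HK w s sr ws u ur.
have [H1 _] := HK w s sr ws u ur.
have [H0 _] := HK origin s sr (fun j => ltac:(by rewrite cabs0)) u ur.
set a := inv_omega N w u in H1 H2 *; set b := inv_omega N origin u in H0 H2 *.
have uz : u - z != 0 by exact: (circle_sub_neq0 rho).
have u0 : u != 0 by rewrite -cabs_gt0 ur.
have B1 : 1 <= 2 / rho by rewrite ler_pdivlMr// mul1r (le_trans rho1)// ler1n.
have kz : cabs (u - z)^-1 <= 2 / rho.
  rewrite (le_trans (cabs_kernel_le rho _ _ zr ur))//.
  rewrite -[2 / rho]invrK invf_div lef_pV2 ?posrE ?subr_gt0 ?divr_gt0//; lra.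
have k0 : cabs u^-1 <= 2 / rho.
  by rewrite cabsV ur ler_pdivlMr// mulVf ?gt_eqF// ler1n.
rewrite expr1.
have -> : residual x u * u * a / (u - z) - residual x u * u * b / (u - 0) =
  residual x u * (u * ((a - b) * (u - z)^-1 + b * z * ((u - z)^-1 * u^-1))).
  by rewrite subr0; field; rewrite u0 uz.
rewrite !cabsM.
have -> : M * (2 * K * (2 / rho) ^+ 2) * s * rnorm d x =
  M * rnorm d x * (1 * (K * s * (2 / rho) ^+ 2 + K * s * (2 / rho) ^+ 2)) by ring.
rewrite ler_pM ?HM ?mulr_ge0 ?cabs_ge0// ur ler_pM ?cabs_ge0 ?(ltW rho0)//.
rewrite (le_trans (cabsD _ _))// lerD// !cabsM.
  rewrite ler_pM ?cabs_ge0// (le_trans kz)// expr2 ler_peMr//.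
  exact: le_trans ler01 B1.
by rewrite ler_pM ?mulr_ge0 ?cabs_ge0// ?expr2 ler_pM ?cabs_ge0.
Qed.

End LinearizedSystem.

(** * Stability of the linearised problem *)

Section LocalError.
Context {R : realType}.
Local Notation C := (Cplx R).
Variables (rho : R) (L : (C -> C) -> C) (f : C -> C) (m n : nat).
Hypotheses (rho0 : 0 < rho) (rho1 : rho <= 1) (cL : cauchy_mean rho L).
Hypothesis fder : forall u, cabs u <= rho -> derivable f u 1.
Hypothesis fbd : bounded_circle rho f.
Local Notation N := (m + n).+1.
Local Notation d := (m.+1 + n.+1)%N.
Local Notation origin := (fun _ : 'I_N => 0 : C).
Local Notation residual := (residual f m n).
Local Notation moments := (moments L f m n).
Local Notation quotient := (quotient L f m n).
Local Notation numer := (numer m n).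
Local Notation denom := (denom m n).
Local Notation denom0 := (denom0 m n).
Implicit Types (x y : 'rV[C]_d) (w : 'I_N -> C).

Variable x0 : 'rV[C]_d.
Hypotheses (x0_mom : moments origin x0 = 0) (x0_norm : denom0 x0 = 1).
Hypothesis x0_uniq : forall x, moments origin x = 0 -> denom0 x = 0 -> x = 0.

Lemma rnorm_row_mx k l (u : 'rV[C]_k) (v : 'rV[C]_l) :
  rnorm _ (row_mx u v) = rnorm _ u + rnorm _ v.
Proof.
rewrite /rnorm big_split_ord; congr (_ + _); apply: eq_bigr => i _.
  by rewrite row_mxEl.
by rewrite row_mxEr.
Qed.

(** The difference x - denom0 x x0 has vanishing constant denominator coefficient,
    and its moments at the origin equal those of x, which are O(s) because the
    moments at w vanish. The map collecting these data is injective, hence bounded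
    below. *)
Lemma solution_close : exists2 K : R, 0 < K & forall w (s : R), s <= rho / 2 ->
  (forall j, cabs (w j) <= s) -> forall x, moments w x = 0 ->
  rnorm d (x - denom0 x *: x0) <= K * s * rnorm d x.
Proof.
pose g x : 'rV[C]_(N + 1) := row_mx (moments origin x) (denom0 x)%:M.
have or := origin_small rho m n rho0.
have glin c x y : g (c *: x + y) = c *: g x + g y.
  rewrite /g (momentsD rho L f m n rho1 cL fbd)// denom0D.
  by rewrite scale_row_mx add_row_mx scale_scalar_mx raddfD.
have ginj x : g x = 0 -> x = 0.
  rewrite /g -row_mx0 => /eq_row_mx[mx0 dx0]; apply: x0_uniq => //.
  by have := congr1 (fun A : 'M[C]_1 => A 0 0) dx0; rewrite !mxE eqxx mulr1n.
have [c c0 hc] := injective_rnorm_bound _ _ g glin ginj.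
have [K K0 HK] := moments_lip rho L f m n rho0 rho1 cL fbd.
exists ((c + 1) * K); first by rewrite mulr_gt0// ltr_wpDl.
move=> w s sr ws x mx0; have s0 : 0 <= s by rewrite (le_trans _ (ws ord0))// cabs_ge0.
rewrite (le_trans (hc _))//.
have -> : g (x - denom0 x *: x0) = row_mx (moments origin x - moments w x) 0.
  rewrite addrC -scaleNr glin /g x0_mom x0_norm mx0 subr0.
  rewrite scale_row_mx add_row_mx scaler0 add0r; congr row_mx.
  by rewrite scale_scalar_mx -raddfD mulr1 addNr raddf0.
rewrite rnorm_row_mx [X in _ + X](_ : _ = 0) ?addr0; last first.
  by rewrite /rnorm big1// => k _; rewrite mxE cabs0.
rewrite -opprB; have -> : rnorm N (- (moments w x - moments origin x)) =
    rnorm N (moments w x - moments origin x).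
  by rewrite /rnorm; apply: eq_bigr => k _; rewrite mxE cabsN.
rewrite -!mulrA ler_pM ?rnorm_ge0 ?lerDl// mulrA; exact: HK.
Qed.

Lemma quotient0_le : exists2 K : R, 0 < K & forall x,
  cabs (quotient origin x 0) <= K * rnorm d x.
Proof.
have [K K0 HK] := inv_omega_lip rho m n rho0 rho1.
have [M M0 HM] := residual_le rho f m n rho1 fbd.
exists (M * K); first by rewrite mulr_gt0.
move=> x; case: (cL) => Lb _ _ _; apply: Lb => u ur.
have u0 : u != 0 by rewrite -cabs_gt0 ur.
have -> : residual x u * u * inv_omega N origin u / (u - 0) =
  residual x u * inv_omega N origin u.
  by rewrite subr0 mulrAC mulfK.
rewrite cabsM mulrAC ler_pM ?cabs_ge0 ?HM//.
have r20 : 0 <= rho / 2 by rewrite divr_ge0// ltW.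
by have [] := HK origin 0 r20 (fun j => ltac:(by rewrite cabs0)) u ur.
Qed.

Lemma quotient0D x y : quotient origin (x + y) 0 = quotient origin x 0 + quotient origin y 0.
Proof.
have or := origin_small rho m n rho0.
have b x' := boundedM rho _ _ (bounded_moment rho f m n rho1 fbd origin x' 1 or)
  (bounded_kernel rho 0 (or ord0)).
case: (cL) => _ Ll Le _; rewrite /quotient.
have := Ll 1 _ _ (b x) (b y); rewrite mul1r => <-; apply: Le => u _.
by rewrite -[x in residual (x + y)]scale1r residualD expr1; ring.
Qed.

(** By [solution_close] a nonzero solution for nodes of size s cannot have
    denom0 x = 0 when s is small, and a solution with denom0 x = 1 is O(s)-close to
    x0. Hence the quotient V of the residual by omega is O(s)-close to its value a for x0
    at the origin, the denominator is O(s)-close to 1, and the interpolation error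
    is omega V / denom. *)
Lemma local_error : exists K s0 : R, [/\ 0 < K, 0 < s0, s0 <= rho / 2 &
  forall w (s : R), s <= s0 -> (forall j, cabs (w j) <= s) ->
  (forall x, x != 0 -> moments w x = 0 -> denom0 x != 0) /\
  (forall x, moments w x = 0 -> denom0 x = 1 -> forall z, cabs z <= s ->
    (denom x).[z] != 0 /\
    cabs (residual x z / (denom x).[z] - quotient origin x0 0 * \prod_j (z - w j))
      <= K * s * cabs (\prod_j (z - w j)))].
Proof.
have [K1 K10 HK1] := solution_close.
have [K2 K20 HK2] := quotient_lip rho L f m n rho0 rho1 cL fbd.
have [K3 K30 HK3] := quotient0_le.
set a := quotient origin x0 0.
pose X := rnorm d x0.
have X1 : 1 <= X.
  by rewrite -[1]cabs1 -x0_norm; exact: le_rnorm.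
have X0 : 0 < X by rewrite (lt_le_trans _ X1).
pose K := 2 * (K2 * (2 * X) + K3 * (K1 * (2 * X)) + cabs a * (2 * X)).
have K0 : 0 < K.
  rewrite mulr_gt0// ltr_wpDr ?mulr_ge0 ?cabs_ge0 ?(ltW X0)//.
  by rewrite addr_gt0// !mulr_gt0.
(* K1 s <= 1/2 absorbs the perturbation; X s <= 1/4 keeps the denominator above 1/2. *)
pose s0 := Num.min (rho / 2) (Num.min (K1^-1 / 2) (X^-1 / 4)).
exists K, s0; split => //.
- by rewrite !lt_min !divr_gt0 ?invr_gt0.
- by rewrite ge_min lexx.
move=> w s; rewrite !le_min => /and3P[sr sK1 sX] ws.
have s_ge0 : 0 <= s by rewrite (le_trans _ (ws ord0))// cabs_ge0.
have K1s : K1 * s <= 1 / 2.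
  by rewrite mulrC -ler_pdivlMr// mulrC mul1r.
have Xs : 2 * X * s <= 1 / 2.
  have := ler_wpM2l (ltW X0) sX; rewrite mulrA mulfV ?gt_eqF// mul1r; lra.
have wr j : cabs (w j) < rho.
  by rewrite (le_lt_trans (ws j))// (le_lt_trans sr)// gtr_pMr// invf_lt1// ltr1n.
split=> [x xn0 mx0|x mx0 dx z zs].
  apply/eqP => dx0; move/eqP: xn0; apply; apply: rnorm_eq0.
  have := HK1 w s sr ws x mx0; rewrite dx0 scale0r subr0 => H.
  have := ler_wpM2r (rnorm_ge0 _ x) K1s; have := rnorm_ge0 _ x; lra.
have := HK1 w s sr ws x mx0; rewrite dx scale1r; set y := x - x0 => Hy.
have xE : x = x0 + y by rewrite /y addrC subrK.
have hx : rnorm d x <= 2 * X.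
  have := rnormD _ x0 y; rewrite -xE -/X => H.
  have := ler_wpM2r (rnorm_ge0 _ x) K1s; lra.
have z1 : cabs z <= 1.
  rewrite (le_trans zs)// (le_trans sr)// (le_trans _ rho1)// ler_piMr ?(ltW rho0)//.
  by rewrite invf_le1// ler1n.
have zr : cabs z < rho.
  by rewrite (le_lt_trans zs)// (le_lt_trans sr)// gtr_pMr// invf_lt1// ltr1n.
have hq : cabs ((denom x).[z] - 1) <= 2 * X * s.
  have := denom_sub_le m n x z z1; rewrite dx => /le_trans; apply.
  by rewrite ler_pM ?rnorm_ge0 ?cabs_ge0.
have hq2 : 1 / 2 <= cabs (denom x).[z].
  exact: cabs_ge_half hq Xs.
have q0 : (denom x).[z] != 0 by rewrite -cabs_gt0 (lt_le_trans _ hq2)// divr_gt0.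
split=> //.
rewrite (moments0_eq0P rho L f m n rho1 cL fder fbd w x wr mx0 z zr).
set V := quotient w x z; set q := (denom x).[z]; set Om := \prod_j _.
have -> : V * Om / q - a * Om = (V - a - a * (q - 1)) / q * Om by field.
rewrite cabsM ler_wpM2r ?cabs_ge0// cabsM cabsV ler_pdivrMr ?cabs_gt0//.
have HV : cabs (V - a) <= K2 * s * (2 * X) + K3 * (K1 * s * (2 * X)).
  have -> : V - a = (V - quotient origin x 0) + quotient origin y 0.
    have -> : quotient origin x 0 = a + quotient origin y 0 by rewrite xE quotient0D.
    by ring.
  rewrite (le_trans (cabsD _ _))// lerD//.
    rewrite (le_trans (HK2 w s sr ws x z zs))// ler_wpM2l// mulr_ge0// ltW//.
  rewrite (le_trans (HK3 y))// ler_wpM2l ?(ltW K30)// (le_trans Hy)//.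
  by rewrite ler_wpM2l// mulr_ge0// ltW.
apply: (@le_trans _ _ (K * s * (1 / 2))); last first.
  by rewrite ler_wpM2l// mulr_ge0// ltW.
rewrite (le_trans (cabsB _ _))// cabsM.
have := ler_wpM2l (cabs_ge0 a) hq; rewrite /K; lra.
Qed.

End LocalError.

(** * Newton-Pade approximants at small nodes *)

Section NewtonPadeLocal.
Context {R : realType}.
Local Notation C := (Cplx R).

Lemma derivable_near_eq (g h : C -> C) z (e : R) : 0 < e ->
  (forall y, cabs (y - z) < e -> g y = h y) -> derivable h z 1 -> derivable g z 1.
Proof.
move=> e0 gh /derivable_cabsP[c hc]; apply/derivable_cabsP; exists c => eta eta0.
have [d d0 hd] := hc _ eta0.
exists (Num.min d e); first by rewrite lt_min d0 e0.
move=> y; rewrite lt_min => /andP[yd ye]; rewrite !gh//; first exact: hd.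
by rewrite subrr cabs0.
Qed.

Lemma derivable_prod_kernel (I : Type) (s : seq I) (w : I -> C) z :
  (forall i, z - w i != 0) -> derivable (fun y => \prod_(i <- s) (y - w i)^-1) z 1.
Proof.
move=> zw; elim: s => [|i s IH].
  have -> : (fun y => \prod_(i <- [::]) (y - w i)^-1) = (fun=> 1 : C).
    by apply/funext => y; rewrite big_nil.
  exact: derivable_cst.
have -> : (fun y => \prod_(i <- i :: s) (y - w i)^-1) =
    (fun y => (y - w i)^-1 * \prod_(i <- s) (y - w i)^-1).
  by apply/funext => y; rewrite big_cons.
apply: derivableCM IH; apply: derivableCV; first exact: zw.
by apply: derivableCB (derivable_cst _ _ _); exact: derivable_id.
Qed.

Variables (E : set C) (f : C -> C) (m n : nat).
Local Notation N := (m + n).+1.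
Local Notation d := (m.+1 + n.+1)%N.
Hypothesis holf : holomorphic_on E f.
Variables (rho : R) (L : (C -> C) -> C).
Hypotheses (rho0 : 0 < rho) (rho1 : rho <= 1) (cL : cauchy_mean rho L).
Hypothesis rhoE : forall z, cabs z <= rho -> E z.
Hypothesis fbd : bounded_circle rho f.
Local Notation origin := (fun _ : 'I_N => 0 : C).
Local Notation residual := (residual f m n).
Local Notation moments := (moments L f m n).
Local Notation quotient := (quotient L f m n).
Local Notation numer := (numer m n).
Local Notation denom := (denom m n).
Local Notation denom0 := (denom0 m n).
Local Notation frac_of x :=
  (FracField.tofrac (numer x) / FracField.tofrac (denom x) : ratfun R).
Implicit Types (x : 'rV[C]_d) (w : 'I_N -> C).

Let fder u : cabs u <= rho -> derivable f u 1.
Proof. by move=> ur; apply: holf; exact: rhoE. Qed.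

Let half_lt : rho / 2 < rho.
Proof.
by rewrite gtr_pMr// invf_lt1// ltr1n.
Qed.

(** Inside the circle the quotient is a Cauchy transform, hence holomorphic even at
    the nodes; outside rho / 2, where the nodal polynomial has no zeros, it is the
    plain quotient. The two agree on the annulus in between. *)
Lemma newton_pade_of_moments w x : (forall j, cabs (w j) <= rho / 2) ->
  moments w x = 0 -> denom x != 0 -> newton_pade E f m n w (frac_of x).
Proof.
move=> wr mx0 dx; have wr' j : cabs (w j) < rho by exact: le_lt_trans (wr j) half_lt.
split=> [j|]; first by apply: rhoE; exact: ltW.
pose g (y : C) : C := residual x y * inv_omega N w y.
pose v (y : C) : C := if cabs y < rho then quotient w x y else g y.
have resE z : cabs z < rho -> residual x z = quotient w x z * \prod_j (z - w j).
  exact: (moments0_eq0P rho L f m n rho1 cL fder fbd w x wr' mx0).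
have far z j : rho / 2 < cabs z -> z - w j != 0.
  move=> hz; rewrite -cabs_gt0 (lt_le_trans _ (cabs_sub_ge _ _))// subr_gt0.
  exact: le_lt_trans (wr j) hz.
have gv z : rho / 2 < cabs z -> v z = g z.
  move=> hz; rewrite /v; case: ifP => // zr; rewrite /g (resE _ zr) -mulrA.
  by rewrite [_ * inv_omega _ _ _]mulrC inv_omegaK ?mulr1// => j; exact: far.
exists (numer x), (denom x), v; split.
- by rewrite deg_le_nat size_numer.
- by rewrite deg_le_nat size_denom.
- exact: dx.
- move=> z Ez; have [zr|rz] := ltP (cabs z) rho.
    apply: (@derivable_near_eq v (quotient w x) z (rho - cabs z)).
    + by rewrite subr_gt0.
    + move=> y yz; rewrite /v; case: ifP => // /negP[].
      by have := cabs_sub_ge y z; lra.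
    + exact: (quotient_derivable rho L f m n rho1 cL fbd w x z wr' zr).
  apply: (@derivable_near_eq v g z (rho / 2)).
  + by rewrite divr_gt0.
  + move=> y yz; apply: gv; have := cabs_sub_ge z y; rewrite cabsBC; lra.
  + apply: derivableCM.
      apply: derivableCB (derivable_horner _ _) _.
      by apply: derivableCM (derivable_horner _ _) _; exact: holf.
    apply: derivable_prod_kernel => j; apply: far; exact: lt_le_trans half_lt rz.
- split=> // z Ez; have [zr|rz] := ltP (cabs z) rho.
    by rewrite /v zr -(resE _ zr).
  have hz := lt_le_trans half_lt rz.
  rewrite (gv _ hz) /g -mulrA inv_omegaK ?mulr1// => j; exact: far.
Qed.

Lemma moments_of_newton_pade w r : (forall j, cabs (w j) < rho) ->
  newton_pade E f m n w r ->
  exists x, [/\ moments w x = 0, denom x != 0 & r = frac_of x].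
Proof.
move=> wr [_ [p [q [v [pm qn q0 hv [pqE rE]]]]]].
move: pm qn; rewrite !deg_le_nat => pm qn.
have [x [xp xq]] := numer_denom_surj m n p q pm qn.
exists x; rewrite xp xq; split => //.
apply: (moments_eq0 rho L f m n rho0 cL w x v wr) => u ur; have Eu := rhoE u ur.
  exact: hv.
by rewrite /residual xp xq pqE.
Qed.

Lemma numer_scale c x : numer (c *: x) = c *: numer x.
Proof. by have := numerD m n c x 0; rewrite addr0 => ->; rewrite /numer !linear0 addr0. Qed.
Lemma denom_scale c x : denom (c *: x) = c *: denom x.
Proof. by have := denomD m n c x 0; rewrite addr0 => ->; rewrite /denom !linear0 addr0. Qed.
Lemma moments_scale w c x : (forall j, cabs (w j) < rho) ->
  moments w x = 0 -> moments w (c *: x) = 0.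
Proof.
move=> wr mx0.
have := momentsD rho L f m n rho1 cL fbd w c (0 : 'rV[C]_d) 0 wr.
rewrite scaler0 addr0 => m00.
have m0 : moments w (0 : 'rV[C]_d) = 0.
  apply/eqP; have /eqP := momentsD rho L f m n rho1 cL fbd w 1 (0 : 'rV[C]_d) 0 wr.
  by rewrite scaler0 addr0 scale1r -{1}[moments w 0]addr0 (inj_eq (addrI _)) eq_sym.
by rewrite -[c *: x]addr0 (momentsD rho L f m n rho1 cL fbd)// mx0 m0 scaler0 addr0.
Qed.

Lemma frac_of_scale c x : c != 0 -> frac_of (c *: x) = frac_of x.
Proof.
move=> c0; rewrite numer_scale denom_scale -!mul_polyC !rmorphM /= -mulf_div divff ?mul1r//.
by rewrite tofrac_eq0 polyC_eq0.
Qed.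

Variables (rP : ratfun R).
Hypotheses (hrP : newton_pade E f m n origin rP) (nondeg : nondegenerate_rf m n rP).

Lemma residual_at0 x : moments origin x = 0 -> residual x 0 = 0.
Proof.
move=> mx0; have or := origin_small rho m n rho0.
rewrite (moments0_eq0P rho L f m n rho1 cL fder fbd origin x or mx0 0 (or ord0)).
by rewrite (bigD1 ord0)//= subrr mul0r mulr0.
Qed.

(** If the denominator vanished at 0 so would the numerator, as p - q f does. *)
Lemma nondeg_denom0 x : moments origin x = 0 -> denom x != 0 -> rP = frac_of x ->
  denom0 x != 0.
Proof.
move=> mx0 dx rE; apply/eqP => d0.
apply: (nondegenerate_at0 m n rP (numer x) (denom x)) => //.
- by rewrite deg_le_nat size_numer.
- by rewrite deg_le_nat size_denom.
- by have := residual_at0 x mx0; rewrite /residual denom_at0 d0 mul0r subr0.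
- by rewrite denom_at0.
Qed.

Lemma pade_normalized : exists x0, [/\ moments origin x0 = 0, denom0 x0 = 1 & rP = frac_of x0].
Proof.
have or := origin_small rho m n rho0.
have [x [mx dx rE]] := moments_of_newton_pade origin rP or hrP.
have d0 := nondeg_denom0 x mx dx rE.
exists ((denom0 x)^-1 *: x); split.
- exact: moments_scale.
- by rewrite /denom0 mxE mulVf.
- by rewrite frac_of_scale// invr_eq0.
Qed.

(** Two solutions at the origin satisfy numer x denom x0 - numer x0 denom x =
    O(z ^ N), a polynomial of degree less than N, so it vanishes and x represents
    rP as well; denom0 x = 0 is then excluded by nondegeneracy unless x = 0. *)
Lemma pade_uniq x0 x : moments origin x0 = 0 -> denom0 x0 = 1 -> rP = frac_of x0 ->
  moments origin x = 0 -> denom0 x = 0 -> x = 0.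
Proof.
move=> mx0 d1 rE mx d0; have or := origin_small rho m n rho0.
have dx0 : denom x0 != 0.
  apply/eqP => dx0; have := denom_at0 m n x0; rewrite dx0 horner0 d1 => /eqP.
  by rewrite eq_sym oner_eq0.
have [K K0 HK] := quotient_lip rho L f m n rho0 rho1 cL fbd.
have qb (y : 'rV[C]_d) : exists B : R, forall z, cabs z < rho / 2 -> cabs (quotient origin y z) <= B.
  exists (cabs (quotient origin y 0) + K * (rho / 2) * rnorm d y) => z zr.
  have -> : quotient origin y z =
    quotient origin y 0 + (quotient origin y z - quotient origin y 0) by ring.
  rewrite (le_trans (cabsD _ _))// lerD2l; apply: HK (ltW zr) => // j.
  by rewrite cabs0 divr_ge0// ltW.
have T0 : numer x * denom x0 - numer x0 * denom x = 0.
  have [B HB] := qb x; have [B0 HB0] := qb x0.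
  pose M := `|B| * rnorm d x0 + `|B0| * rnorm d x.
  have r20 : 0 < rho / 2 by rewrite divr_gt0.
  apply: (@poly_eq0_small R N _ M (rho / 2)) => //.
    rewrite (leq_trans (size_polyD _ _))// size_polyN geq_max.
    have sz (p q : {poly C}) : (size p <= m.+1)%N -> (size q <= n.+1)%N ->
        (size (p * q)%R <= N)%N.
      by move=> sp sq; rewrite (leq_trans (size_polyMleq _ _))//; lia.
    by rewrite !sz ?size_numer ?size_denom.
  move=> z z0 zr; have zr' : cabs z < rho := lt_trans zr half_lt.
  have z1 : cabs z <= 1 by rewrite (le_trans (ltW zr'))//.
  have RE (y : 'rV[C]_d) : moments origin y = 0 -> residual y z = quotient origin y z * z ^+ N.
    move=> my; rewrite (moments0_eq0P rho L f m n rho1 cL fder fbd origin y or my z zr').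
    by rewrite subr0 prodr_const card_ord.
  have -> : (numer x * denom x0 - numer x0 * denom x).[z] =
      (quotient origin x z * (denom x0).[z] - quotient origin x0 z * (denom x).[z]) * z ^+ N.
    have := RE x mx; have := RE x0 mx0; rewrite /residual => E1 E2.
    rewrite mulrBl mulrAC [_ * _ * z ^+ N]mulrAC -E1 -E2.
    by rewrite hornerD hornerN !hornerM; ring.
  rewrite cabsM cabsX ler_wpM2r ?exprn_ge0 ?cabs_ge0//.
  rewrite (le_trans (cabsB _ _))// !cabsM lerD// ler_pM ?cabs_ge0 ?denom_le//.
    by rewrite (le_trans (HB z zr))// ler_norm.
  by rewrite (le_trans (HB0 z zr))// ler_norm.
have [dx|dx] := eqVneq (denom x) 0.
  apply: (numer_denom_inj m n) => //; apply/eqP.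
  by move/eqP: T0; rewrite dx mulr0 subr0 mulf_eq0 (negPf dx0) orbF.
have rE' : rP = frac_of x.
  rewrite rE; apply/eqP; rewrite eqr_div ?tofrac_eq0// -!rmorphM tofrac_eq.
  by rewrite eq_sym -subr_eq0 T0.
by have := nondeg_denom0 x mx dx rE'; rewrite d0 eqxx.
Qed.

(** The error of rP is z ^ N V(z) / denom(z) with V Lipschitz at 0 and
    denom(0) = 1, so its leading coefficient is V(0). *)
Lemma leading_coef_eq x0 (a : C) (k e : R) : 0 < e ->
  (forall z, cabs z < e -> cabs (rf_eval rP z - f z - a * z ^+ N) <= k * cabs z ^+ N.+1) ->
  moments origin x0 = 0 -> denom0 x0 = 1 -> rP = frac_of x0 -> 
  quotient origin x0 0 = a.
Proof.
move=> e0 ha mx0 d1 rE; have or := origin_small rho m n rho0.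
have [K K0 HK] := quotient_lip rho L f m n rho0 rho1 cL fbd.
pose X := rnorm d x0.
have X0 : 0 <= X by exact: rnorm_ge0.
apply/eqP; rewrite -subr_eq0 -cabs_eq0 eq_le cabs_ge0 andbT.
pose s1 := Num.min (rho / 2) (Num.min e ((X + 1)^-1 / 2)).
have s10 : 0 < s1 by rewrite !lt_min e0 !divr_gt0 ?invr_gt0 ?ltr_wpDl.
apply: (@le_small_eq0 _ _ (K * X + `|k| * X + cabs a * X) s1) => // t /andP[t0].
rewrite !lt_min => /and3P[tr te tX].
pose z : C := toC t; have zt : cabs z = t by rewrite cabs_toC gtr0_norm.
have zr : cabs z < rho by rewrite zt (lt_trans tr).
have z1 : cabs z <= 1 by rewrite (le_trans (ltW zr)).
have z0 : z != 0 by rewrite -cabs_gt0 zt.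
have Xt : X * t <= 1 / 2.
  apply: (@le_trans _ _ ((X + 1) * t)); first by rewrite ler_wpM2r ?(ltW t0)// lerDl.
  have := ler_wpM2l (_ : 0 <= X + 1) (ltW tX); rewrite mulrA mulfV ?gt_eqF ?ltr_wpDl//.
  by apply; rewrite addr_ge0.
have hq : cabs ((denom x0).[z] - 1) <= X * t.
  by have := denom_sub_le m n x0 z z1; rewrite d1 zt.
have hq2 : 1 / 2 <= cabs (denom x0).[z].
  exact: cabs_ge_half hq Xt.
have q0 : (denom x0).[z] != 0 by rewrite -cabs_gt0 (lt_le_trans _ hq2)// divr_gt0.
have [_ evE] := rf_eval_frac (numer x0) (denom x0) rP z q0 rE.
have := ha z; rewrite zt => /(_ te); rewrite evE.
have RE : residual x0 z = quotient origin x0 z * z ^+ N.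
  rewrite (moments0_eq0P rho L f m n rho1 cL fder fbd origin x0 or mx0 z zr).
  by rewrite subr0 prodr_const card_ord.
set V := quotient origin x0 z in RE; set q := (denom x0).[z] in q0 hq hq2 *.
have -> : (numer x0).[z] / q - f z - a * z ^+ N = (V - a * q) / q * z ^+ N.
  have -> : (numer x0).[z] = V * z ^+ N + q * f z.
    by rewrite -RE /residual -/q subrK.
  by field.
rewrite cabsM cabsX zt [in leRHS]exprSr mulrA mulrAC ler_pM2r ?exprn_gt0// cabsM cabsV.
rewrite ler_pdivrMr ?cabs_gt0// => Vq.
have HV := HK origin t (ltW tr) (fun j => ltac:(by rewrite cabs0 ltW)) x0 z (ltac:(by rewrite zt)).
rewrite -/V -/X in HV.
have -> : quotient origin x0 0 - a = (V - a * q) + a * (q - 1) - (V - quotient origin x0 0) by ring.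
rewrite (le_trans (cabsB _ _))// (le_trans (lerD (cabsD _ _) (lexx _)))//.
rewrite cabsM.
have H1 : cabs a * cabs (q - 1) <= cabs a * (X * t) by rewrite ler_wpM2l ?cabs_ge0.
have qX : cabs q <= X by exact: denom_le.
have H2 : k * t * cabs q <= `|k| * X * t.
  rewrite mulrAC ler_wpM2r ?(ltW t0)//.
  apply: (@le_trans _ _ (`|k| * cabs q)); first by rewrite ler_wpM2r ?cabs_ge0 ?ler_norm.
  by rewrite ler_wpM2l.
have -> : (K * X + `|k| * X + cabs a * X) * t =
  `|k| * X * t + cabs a * (X * t) + K * t * X by ring.
by apply: lerD => //; apply: lerD => //; exact: le_trans Vq H2.
Qed.

End NewtonPadeLocal.

(** The radius rho is chosen so that f is holomorphic and bounded on the closed disc;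
    there the Cauchy functional linearises the interpolation problem, the Pade
    approximant provides the base solution x0, and [local_error] applies. The
    leading error coefficient a of the Pade approximant thus governs all
    interpolants with nodes near 0, uniformly in the nodes. *)
Lemma newton_pade_local (R : realType) (E : set (Cplx R)) (f : Cplx R -> Cplx R)
    (m n : nat) (rP : ratfun R) (a : Cplx R) (k e : R) :
  open E -> E 0 -> holomorphic_on E f ->
  newton_pade E f m n (fun=> 0) rP -> nondegenerate_rf m n rP -> 0 < e ->
  (forall z, cabs z < e ->
     cabs (rf_eval rP z - f z - a * z ^+ (m + n).+1) <= k * cabs z ^+ (m + n).+2) ->
  exists K s0 : R, [/\ 0 < K, 0 < s0 &
    forall (w : 'I_(m + n).+1 -> Cplx R) (s : R), s <= s0 -> (forall j, cabs (w j) <= s) ->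
    (exists r, newton_pade E f m n w r) /\
    (forall r, newton_pade E f m n w r -> forall z, cabs z <= s ->
      ~~ rf_pole r z /\
      cabs (rf_eval r z - f z - a * \prod_j (z - w j))
        <= K * s * cabs (\prod_j (z - w j)))].
Proof.
move=> oE E0 holf hrP nondeg e0 ha.
have [B [d1 [d10 hd1]]] := derivable_cabs_bound f 0 (holf 0 E0).
have /nbhs_cabs[d2 d20 hd2] : nbhs (0 : Cplx R) E by exact: open_nbhs_nbhs.
pose rho := Num.min 1 (Num.min (d1 / 2) (d2 / 2)).
have rho0 : 0 < rho by rewrite !lt_min ltr01 !divr_gt0.
have rho1 : rho <= 1 by rewrite ge_min lexx.
have rd1 : rho < d1.
  rewrite (le_lt_trans (_ : _ <= d1 / 2))// ?gtr_pMr ?invf_lt1 ?ltr1n//.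
  by rewrite !ge_min lexx orbT.
have rd2 : rho < d2.
  rewrite (le_lt_trans (_ : _ <= d2 / 2))// ?gtr_pMr ?invf_lt1 ?ltr1n//.
  by rewrite !ge_min lexx !orbT.
have rhoE z : cabs z <= rho -> E z.
  by move=> zr; apply: hd2; rewrite subr0 (le_lt_trans zr).
have fbd : bounded_circle rho f.
  exists (B * rho + cabs (f 0)) => u ur.
  have fu := hd1 u; rewrite subr0 ur in fu; have {fu} := fu rd1.
  by have := cabs_sub_ge (f u) (f 0); clear; lra.
have [L cL] := cauchy_functional rho rho0.
have [x0 [mx0 dx0 rE]] := pade_normalized E f m n holf rho L rho0 rho1 cL rhoE fbd rP hrP nondeg.
have uniq x := pade_uniq E f m n holf rho L rho0 rho1 cL rhoE fbd rP nondeg x0 x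
  mx0 dx0 rE.
have fder u : cabs u <= rho -> derivable f u 1 by move=> /rhoE; exact: holf.
have aE := leading_coef_eq E f m n holf rho L rho0 rho1 cL rhoE fbd rP x0 a k e e0 ha mx0 dx0 rE.
have [K [s0 [K0 s00 s0r HK]]] := local_error rho L f m n rho0 rho1 cL fder fbd x0 mx0 dx0 uniq.
exists K, s0; split => // w s ss0 ws.
have [H1 H2] := HK w s ss0 ws.
have wr j : cabs (w j) <= rho / 2 by rewrite (le_trans (ws j))// (le_trans ss0).
have wr' j : cabs (w j) < rho.
  by rewrite (le_lt_trans (wr j))// gtr_pMr// invf_lt1// ltr1n.
have dn0 x : denom0 m n x != 0 -> denom m n x != 0.
  by apply: contraNneq => dx; rewrite -denom_at0 dx horner0.
split.
  have [x xn0 mx] := moments_ker rho L f m n rho1 cL fbd w wr'.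
  eexists; apply: (newton_pade_of_moments E f m n holf rho L rho0 rho1 cL rhoE fbd w x wr mx).
  exact/dn0/H1.
move=> r hr z zs.
have [x [mx dx rxE]] := moments_of_newton_pade E f m n rho L rho0 cL rhoE w r wr' hr.
have xn0 : x != 0.
  by apply: contraNneq dx => ->; rewrite /denom !linear0.
have d0 := H1 x xn0 mx.
pose y := (denom0 m n x)^-1 *: x.
have my : moments L f m n w y = 0.
  exact: (moments_scale f m n rho L rho1 cL fbd w _ x wr' mx).
have dy : denom0 m n y = 1 by rewrite /denom0 mxE mulVf.
have ryE : r = FracField.tofrac (numer m n y) / FracField.tofrac (denom m n y).
  by rewrite rxE /y frac_of_scale// invr_eq0.
have [qz err] := H2 y my dy z zs.
have [npole ev] := rf_eval_frac _ _ r z qz ryE.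
split=> //; rewrite ev; move: err; rewrite aE /residual.
by congr (cabs (_ - _) <= _); field.
Qed.

(** * Chebyshev nodes: uniqueness and stability *)

Section Chebyshev.
Context {R : realType}.
Local Notation C := (Cplx R).

Lemma compact_cabs_bounded (K : set C) : compact K ->
  exists2 B : R, 0 < B & forall z, K z -> cabs z <= B.
Proof.
move=> cK; have cont : continuous (@cabs R : C -> R).
  move=> z; apply/(@cvgrPdist_lt _ _ _ (nbhs z) (nbhs_filter z)) => e e0.
  apply/near_cabs; exists e => // y yz.
  by rewrite (le_lt_trans (cabs_dist _ _))// cabsBC.
have : compact (@cabs R @` K).
  by apply: continuous_compact cK; exact: continuous_subspaceT.
move=> /compact_bounded[M [_ HM]]; exists (`|M| + 1); first by rewrite ltr_wpDl.
have M1 : M < `|M| + 1 by rewrite (le_lt_trans (ler_norm _))// ltrDl.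
move=> z Kz; have := HM _ M1 (cabs z) (ex_intro2 _ _ z Kz erefl).
by rewrite /= ger0_norm ?cabs_ge0.
Qed.

(** If p vanished on K, every point of K would be isolated among the zeros of p. *)
Lemma poly_neq0_on_perfect (K : set C) (p : {poly C}) :
  K !=set0 -> isolated K = set0 -> p != 0 -> exists2 z, K z & p.[z] != 0.
Proof.
move=> [z0 Kz0] isoK p0; apply: contrapT => nex.
have Kroot z : K z -> root p z.
  move=> Kz; rewrite rootE; apply/negPn/negP => pz; apply: nex; by exists z.
have [s sE] := closed_field_poly_normal p.
have Ks z : K z -> z \in s.
  by move=> /Kroot; rewrite sE rootZ ?lead_coef_eq0// root_prod_XsubC.
have : isolated K z0; last by rewrite isoK.
split; first exact/mem_set.
have [d d0 hd] : exists2 d : R, 0 < d & forall y, y \in s -> y != z0 -> d <= cabs (y - z0).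
  elim: (s) => [|x r [d d0 hd]]; first by exists 1.
  have [->|xz] := eqVneq x z0.
    exists d => // y; rewrite inE => /predU1P[->|]; [by rewrite eqxx|exact: hd].
  exists (Num.min d (cabs (x - z0))).
    by rewrite lt_min d0 cabs_gt0 subr_eq0.
  move=> y; rewrite inE => /predU1P[->|yr yz]; first by rewrite ge_min lexx orbT.
  by rewrite ge_min hd.
exists [set y | cabs (y - z0) < d].
  by apply/nbhs_cabs; exists d.
apply/seteqP; split => [y [/= yd Ky]|_ ->]; last by split => //=; rewrite subrr cabs0.
apply: contrapT => /eqP yz; move: yd; apply/negP; rewrite -leNgt.
by apply: hd => //; exact: Ks.
Qed.

Lemma cabs_sqr (z : C) : cabs z ^+ 2 = complex.Re z ^+ 2 + complex.Im z ^+ 2.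
Proof. by case: z => x y; rewrite /cabs/= sqr_sqrtr// addr_ge0 ?sqr_ge0. Qed.

Lemma parallelogram (u v : C) :
  cabs (u - v) ^+ 2 + cabs (u + v) ^+ 2 = 2 * cabs u ^+ 2 + 2 * cabs v ^+ 2.
Proof. by rewrite !cabs_sqr; case: u => a b; case: v => c d /=; ring. Qed.

(** By the parallelogram law |u + v| ^ 2 <= 4 t ^ 2 - eta ^ 2, and the difference of
    squares 4 t ^ 2 - |u + v| ^ 2 is at most 4 t (2 t - |u + v|). *)
Lemma midpoint_gap (u v : C) (t eta : R) : 0 < t -> 0 < eta -> cabs u <= t -> cabs v <= t ->
  eta <= cabs (u - v) -> cabs (2^-1 * (u + v)) <= t - eta ^+ 2 / (8 * t).
Proof.
move=> t0 e0 ut vt euv; have := parallelogram u v.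
rewrite cabsM cabsV cabs_nat.
set A := cabs (u + v); have A0 : 0 <= A by exact: cabs_ge0.
have u0 := cabs_ge0 u; have v0 := cabs_ge0 v.
set x := cabs u in ut u0 *; set y := cabs v in vt v0 *; set D := cabs (u - v) in euv *.
move=> E; rewrite leNgt; apply/negP => lt1.
have A2t : A <= 2 * t by have := cabsD u v; rewrite -/A -/x -/y; lra.
have x2 : x ^+ 2 <= t ^+ 2 by rewrite ler_sqr ?nnegrE// ltW.
have y2 : y ^+ 2 <= t ^+ 2 by rewrite ler_sqr ?nnegrE// ltW.
have D2 : eta ^+ 2 <= D ^+ 2 by rewrite ler_sqr ?nnegrE ?cabs_ge0// ltW.
pose k := eta ^+ 2 / (8 * t); have kE : k * t = eta ^+ 2 / 8.
  by rewrite /k; field; rewrite gt_eqF.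
have Ak : A > 2 * (t - k) by rewrite /k; lra.
have : (2 * t - A) * (2 * t + A) < 2 * k * (4 * t).
  apply: (@le_lt_trans _ _ ((2 * t - A) * (4 * t))).
    by rewrite ler_wpM2l//; lra.
  by rewrite ltr_pM2r//; lra.
have -> : (2 * t - A) * (2 * t + A) = 4 * t ^+ 2 - A ^+ 2 by ring.
have -> : 2 * k * (4 * t) = 8 * (k * t) by ring.
rewrite kE; lra.
Qed.

Section NodeMax.
Variables (K : set C) (N : nat).
Hypotheses (K0 : K !=set0) (cK : compact K).
Implicit Types (zeta : 'I_N -> C).

Lemma node_max_has_sup zeta : has_sup [set \prod_j cabs (z - zeta j) | z in K].
Proof.
have [B B0 HB] := compact_cabs_bounded K cK.
have [z0 Kz0] := K0; split; first by exists (\prod_j cabs (z0 - zeta j)), z0.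
exists (\prod_j (B + cabs (zeta j))) => _ [z Kz <-].
apply: ler_prod => j _; rewrite cabs_ge0/= (le_trans (cabsB _ _))// lerD2r.
exact: HB.
Qed.

Lemma le_node_max zeta z : K z -> \prod_j cabs (z - zeta j) <= node_max K zeta.
Proof. by move=> Kz; apply: sup_upper_bound (node_max_has_sup zeta) _ _; exists z. Qed.

Lemma node_max_le zeta c : (forall z, K z -> \prod_j cabs (z - zeta j) <= c) ->
  node_max K zeta <= c.
Proof.
move=> h; have [z0 Kz0] := K0; apply: ge_sup.
  by exists (\prod_j cabs (z0 - zeta j)), z0.
by move=> _ [z Kz <-]; exact: h.
Qed.

Definition node_poly zeta : {poly C} := \prod_j ('X - (zeta j)%:P).

Lemma size_node_poly zeta : size (node_poly zeta) = N.+1.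
Proof. by rewrite size_prod_XsubC size_index_ord. Qed.

Lemma monic_node_poly zeta : node_poly zeta \is monic.
Proof. exact: monic_prod_XsubC. Qed.

Lemma node_polyE zeta z : (node_poly zeta).[z] = \prod_j (z - zeta j).
Proof. by rewrite horner_prod; apply: eq_bigr => j _; rewrite hornerXsubC. Qed.

Lemma cabs_node_poly zeta z : cabs (node_poly zeta).[z] = \prod_j cabs (z - zeta j).
Proof. by rewrite node_polyE cabs_prod. Qed.

Lemma monic_node_polyP (p : {poly C}) : p \is monic -> size p = N.+1 ->
  exists zeta, p = node_poly zeta.
Proof.
move=> pm sp; have [s sE] := closed_field_poly_normal p.
move: sE; rewrite (monicP pm) scale1r => sE.
have ss : size s = N by move: sp; rewrite sE size_prod_XsubC => -[].
exists (fun j => nth 0 s j); rewrite sE (big_nth 0) ss big_mkord.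
by [].
Qed.

Lemma node_poly_inj_perm zeta xi : node_poly zeta = node_poly xi ->
  exists s : {perm 'I_N}, forall j, zeta (s j) = xi j.
Proof.
move=> E; pose tz := [tuple zeta i | i < N]; pose tx := [tuple xi i | i < N].
have : perm_eq tx tz.
  apply: prod_XsubC_eq; rewrite !big_map; symmetry.
  by move: E; rewrite /node_poly [index_enum _]unlock -!enumT.
move=> /tuple_permP[s sE]; exists s => j.
have := congr1 (fun r => nth 0 r j) sE.
by rewrite -!tnth_nth !tnth_mktuple.
Qed.

(** With D the difference of two optimal polynomials and T their mean, |T| is
    bounded away from the optimum t where |D| is not small ([midpoint_gap]), while
    where D is small T is close to its remainder q modulo D. As deg q < N, the
    polynomial T - de q is still monic of degree N; for small de > 0 it damps T
    where T is close to q and changes T by less than the gap elsewhere, so it beats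
    the optimum. *)
Lemma chebyshev_unique (tau sigma : 'I_N -> C) : isolated K = set0 ->
  chebyshev_nodes K tau -> node_max K sigma <= node_max K tau ->
  node_poly sigma = node_poly tau.
Proof.
move=> isoK tauP sigmaP; apply/eqP; rewrite -subr_eq0; apply/negPn/negP => D0.
set T1 := node_poly sigma in D0; set T2 := node_poly tau in D0.
set D := T1 - T2 in D0; set t := node_max K tau in sigmaP.
have T1t z : K z -> cabs T1.[z] <= t.
  by move=> Kz; rewrite cabs_node_poly (le_trans (le_node_max _ _ Kz)).
have T2t z : K z -> cabs T2.[z] <= t.
  by move=> Kz; rewrite cabs_node_poly (le_trans (le_node_max _ _ Kz)).
have sD : (size D <= N)%N.
  apply/leq_sizeP => j; rewrite leq_eqVlt coefB => /orP[/eqP <-|Nj].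
    have l1 : T1`_N = 1 by have /monicP := monic_node_poly sigma; rewrite lead_coefE size_node_poly.
    have l2 : T2`_N = 1 by have /monicP := monic_node_poly tau; rewrite lead_coefE size_node_poly.
    by rewrite l1 l2 subrr.
  by rewrite !nth_default ?subrr// size_node_poly.
have [zD KzD DzD] := poly_neq0_on_perfect K D K0 isoK D0.
have t0 : 0 < t.
  rewrite lt_def; have t_ge0 : 0 <= t by rewrite (le_trans (cabs_ge0 T1.[zD]))// T1t.
  rewrite t_ge0 andbT; apply: contraNneq DzD => tE.
  have e1 : T1.[zD] = 0 by apply/eqP; rewrite -cabs_eq0 eq_le cabs_ge0 andbT -tE T1t.
  have e2 : T2.[zD] = 0 by apply/eqP; rewrite -cabs_eq0 eq_le cabs_ge0 andbT -tE T2t.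
  by rewrite hornerD hornerN e1 e2 subrr.
pose T := 2^-1 *: (T1 + T2); pose q := T %% D; pose S := T %/ D.
have TE : T = S * D + q by exact: divp_eq.
have two0 : (2 : C) != 0 by rewrite pnatr_eq0.
have TT2 : T = T2 + 2^-1 *: D.
  rewrite /T /D !scalerDr scalerN addrCA; congr (_ + _).
  have {2}-> : T2 = (2^-1 + 2^-1) *: T2 by rewrite -mulr2n -[_ *+ 2]mulr_natl mulfV// scale1r.
  by rewrite scalerDl addrK.
have sqD : (size q < size D)%N by rewrite ltn_modp.
have TzE z : T.[z] = 2^-1 * (T1.[z] + T2.[z]) by rewrite /T hornerZ hornerD.
clearbody q S T.
have [B B0 HB] := compact_cabs_bounded K cK.
pose B1 := Num.max 1 B.
have B11 : 1 <= B1 by rewrite le_max lexx.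
have bnd (p : {poly C}) : exists2 M : R, 0 < M & forall z, K z -> cabs p.[z] <= M.
  exists ((\sum_(i < size p) cabs p`_i) * B1 ^+ size p + 1).
    apply: ltr_wpDl => //; apply: mulr_ge0.
      by apply: sumr_ge0 => i _; exact: cabs_ge0.
    by rewrite exprn_ge0// (le_trans ler01).
  move=> z Kz; rewrite (le_trans (poly_bounded p B1 B11 z _)) ?lerDl//.
  by rewrite le_max HB ?orbT.
have [M M0 HM] := bnd S; have [Q Q0 HQ] := bnd q.
(* |D| <= eta forces |T - q| = |S D| <= t / 2. *)
pose eta := t / (2 * M); have eta0 : 0 < eta by rewrite divr_gt0// mulr_gt0.
pose kap := eta ^+ 2 / (8 * t).
have kap0 : 0 < kap by rewrite divr_gt0 ?exprn_gt0// mulr_gt0.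
pose de := Num.min 1 (kap / (2 * Q)).
have de0 : 0 < de by rewrite lt_min ltr01 divr_gt0// mulr_gt0.
have de1 : de <= 1 by rewrite ge_min lexx.
have deQ : de * Q <= kap / 2.
  rewrite -ler_pdivlMr// (le_trans (_ : _ <= kap / (2 * Q))) ?ge_min ?lexx ?orbT//.
  by rewrite invfM mulrA.
pose P := T - toC de *: q.
have sq : (size (2^-1 *: D - toC de *: q)%R < size T2)%N.
  rewrite size_node_poly ltnS (leq_trans (size_polyD _ _))// size_polyN geq_max.
  rewrite (leq_trans (size_scale_leq _ _) sD)/= (leq_trans (size_scale_leq _ _))//.
  by rewrite (leq_trans _ sD)// ltnW.
have PE : P = T2 + (2^-1 *: D - toC de *: q) by rewrite /P TT2 addrA.
have sP : size P = N.+1 by rewrite PE size_polyDl// size_node_poly.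
have mP : P \is monic by rewrite PE monicE lead_coefDl// -monicE monic_node_poly.
have [zeta PZ] := monic_node_polyP P mP sP.
have := tauP zeta; rewrite -/t; apply/negP; rewrite -ltNge.
apply: (@le_lt_trans _ _ (Num.max (t - de * t / 2) (t - kap / 2))); last first.
  by rewrite gt_max !gtrDl !oppr_lt0 !divr_gt0// mulr_gt0.
apply: node_max_le => z Kz; rewrite -cabs_node_poly -PZ le_max.
have Tt : cabs T.[z] <= t.
  rewrite TzE cabsM cabsV cabs_nat; have := cabsD T1.[z] T2.[z].
  by have := T1t z Kz; have := T2t z Kz; lra.
have [small|big] := leP (cabs D.[z]) eta; apply/orP; [left|right].
- have -> : P.[z] = toC (1 - de) * T.[z] + toC de * (S.[z] * D.[z]).
    have := congr1 (horner^~ z) TE; rewrite hornerD hornerM => E.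
    rewrite /P hornerD hornerN hornerZ; have -> : q.[z] = T.[z] - S.[z] * D.[z].
      by rewrite E; ring.
    by rewrite toCB toC1; ring.
  rewrite (le_trans (cabsD _ _))// 3!cabsM !cabs_toC (gtr0_norm de0) ger0_norm ?subr_ge0//.
  have SD : cabs S.[z] * cabs D.[z] <= t / 2.
    apply: (@le_trans _ _ (M * eta)); first by rewrite ler_pM ?cabs_ge0 ?HM.
    by rewrite /eta le_eqVlt; apply/orP; left; apply/eqP; field; rewrite gt_eqF.
  have h1 : (1 - de) * cabs T.[z] <= (1 - de) * t by rewrite ler_wpM2l// subr_ge0.
  have h2 := ler_wpM2l (ltW de0) SD.
  by clear -h1 h2; lra.
- have Tk : cabs T.[z] <= t - kap.
    rewrite TzE; apply: midpoint_gap => //; [exact: T1t|exact: T2t|].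
    by apply: ltW; move: big; rewrite /D hornerD hornerN.
  rewrite /P hornerD hornerN hornerZ (le_trans (cabsB _ _))// cabsM cabs_toC (gtr0_norm de0).
  have h2 : de * cabs q.[z] <= de * Q by rewrite ler_wpM2l ?HQ// ltW.
  by clear -Tk h2 deQ; lra.
Qed.

(** Otherwise an ultrafilter limit of worse and worse approximate optima, none of
    them close to tau, would be a second optimum. *)
Lemma chebyshev_stable (tau : 'I_N -> C) (Theta : set C) : isolated K = set0 ->
  chebyshev_nodes K tau -> compact Theta ->
  forall d : R, 0 < d -> exists2 eta : R, 0 < eta &
    forall zeta, (forall j, Theta (zeta j)) -> node_max K zeta <= node_max K tau + eta ->
    exists s : {perm 'I_N}, forall j, cabs (zeta (s j) - tau j) < d.
Proof.
move=> isoK tauP cTh d d0; apply: contrapT => nex.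
have step (k : nat) : exists ze : 'I_N -> C,
    [/\ forall j, Theta (ze j), node_max K ze <= node_max K tau + k.+1%:R^-1 &
      ~ exists s : {perm 'I_N}, forall j, cabs (ze (s j) - tau j) < d].
  apply: contrapT => nk; apply: nex; exists k.+1%:R^-1; first by rewrite invr_gt0.
  move=> zeta zT zm; apply: contrapT => ns; apply: nk; by exists zeta.
have [zk zkP] := boolp.choice step.
have [U [UU sU]] := @ultraFilterLemma nat \oo _.
have [B B0 HB] := compact_cabs_bounded Theta cTh.
have lstep (j : 'I_N) : exists l : C, (fun k => zk k j) @ U --> l.
  apply: (@ultra_bounded_cvg R U _ B UU) => k.
  by apply: HB; have [] := zkP k.
have [lim limP] := boolp.choice lstep.
have near_lim (e : R) : 0 < e -> exists k : nat,
    k.+1%:R^-1 < e /\ forall j, cabs (zk k j - lim j) < e.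
  move=> e0; have : U (fun k : nat => k.+1%:R^-1 < e /\ forall j, cabs (zk k j - lim j) < e).
    apply: filterI.
      by apply: sU; exact: near_infty_natSinv_lt (PosNum e0).
    apply: filter_forall => j; have /cvg_cabs := limP j; exact.
  by move=> /filter_ex.
have [BK BK0 HBK] := compact_cabs_bounded K cK.
have limB j : cabs (lim j) <= B + 1.
  have [k [_ /(_ j) kj]] := near_lim 1 ltr01.
  have [Th _ _] := zkP k; have := HB _ (Th j).
  by have := cabs_sub_ge (lim j) (zk k j); rewrite cabsBC; clear -kj; lra.
have lim_opt : node_max K lim <= node_max K tau.
  apply: node_max_le => z Kz; rewrite -subr_le0.
  pose B' := 1 + BK + (B + 1).
  have B'1 : 1 <= B' by rewrite /B' -addrA lerDl !addr_ge0// ltW.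
  apply: (@le_small_eq0 _ _ (1 + N%:R * B' ^+ N) 1 ltr01) => e /andP[e0 _].
  have [k [ke kj]] := near_lim e e0; have [Th zm _] := zkP k.
  have := @prod_dist R _ (index_enum 'I_N) (fun j => z - lim j) (fun j => z - zk k j) B' e B'1.
  rewrite size_index_ord => pd.
  have {}pd : cabs (\prod_j (z - lim j) - \prod_j (z - zk k j)) <= N%:R * B' ^+ N * e.
    apply: pd => j.
    - by rewrite (le_trans (cabsB _ _))// lerD// (le_trans (HBK z Kz))// lerDr.
    - rewrite (le_trans (cabsB _ _))// lerD//; first by rewrite (le_trans (HBK z Kz))// lerDr.
      by rewrite (le_trans (HB _ (Th j)))// lerDl.
    - have -> : z - lim j - (z - zk k j) = zk k j - lim j by ring.
      exact: ltW.
  have := le_node_max (zk k) z Kz.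
  have := cabs_sub_ge (\prod_j (z - lim j)) (\prod_j (z - zk k j)).
  rewrite 2!cabs_prod; move: (\prod_j cabs _) (\prod_j cabs _) => p1 p2.
  move: (N%:R * B' ^+ N) pd => c pd h1 h2; rewrite mulrDl mul1r.
  have {}zm := le_trans zm (lerD (lexx _) (ltW ke)).
  by clear -pd zm h1 h2; lra.
have := chebyshev_unique tau lim isoK tauP lim_opt => /node_poly_inj_perm[s sE].
have [k [_ kj]] := near_lim d d0; have [_ _] := zkP k; apply.
by exists s => j; rewrite -sE.
Qed.

End NodeMax.
End Chebyshev.

(** * Errors at scaled nodes *)

Section Scaling.
Context {R : realType}.
Local Notation C := (Cplx R).

Lemma near_right0 (P : R -> Prop) (d : R) : 0 < d ->
  (forall e, 0 < e -> e < d -> P e) -> \forall e \near 0^'+, P e.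
Proof.
move=> d0 hP; rewrite near_withinE; apply/nbhs_ballP; exists d => // e /=.
rewrite /ball/= sub0r normrN => ed e0; apply: hP => //.
by rewrite (le_lt_trans (ler_norm _)).
Qed.

Lemma squeeze_le (p q v v' c : R) :
  p - c <= v -> v <= v' -> v' <= q + c -> p <= q + 2 * c.
Proof. by move=> h1 h2 h3; lra. Qed.

Lemma prod_scale N (e z : C) (zeta : 'I_N -> C) :
  \prod_j (e * z - e * zeta j) = e ^+ N * \prod_j (z - zeta j).
Proof.
under eq_bigr do rewrite -mulrBr.
by rewrite big_split /= prodr_const card_ord.
Qed.

Lemma err_norm_fin (K : set C) (e : R) (r : ratfun R) (f : C -> C) (c : R) :
  K !=set0 ->
  (forall z, K z -> ~~ rf_pole r (toC e * z) /\
     cabs (rf_eval r (toC e * z) - f (toC e * z)) <= c) ->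
  [/\ err_norm (dilate e K) r f \is a fin_num, fine (err_norm (dilate e K) r f) <= c &
    forall z, K z -> cabs (rf_eval r (toC e * z) - f (toC e * z)) <=
      fine (err_norm (dilate e K) r f)].
Proof.
move=> [z0 Kz0] h.
have le_c : (err_norm (dilate e K) r f <= c%:E)%E.
  apply: ge_ereal_sup => _ [_ [z Kz <-] <-].
  by have [/negPf -> hz] := h z Kz; rewrite lee_fin.
have ge z : K z -> ((cabs (rf_eval r (toC e * z) - f (toC e * z)))%:E <=
    err_norm (dilate e K) r f)%E.
  move=> Kz; apply: ereal_sup_ubound; exists (toC e * z); first by exists z.
  by have [/negPf ->] := h z Kz.
have fin : err_norm (dilate e K) r f \is a fin_num.
  by rewrite fin_numElt (lt_le_trans (ltNyr _) (ge z0 Kz0)) (le_lt_trans le_c (ltry _)).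
split=> //; first by rewrite -lee_fin fineK.
by move=> z Kz; rewrite -lee_fin fineK// ge.
Qed.

End Scaling.

Section Asymptotics.
Context {R : realType}.
Local Notation C := (Cplx R).
Variables (E : set C) (f : C -> C) (K Theta : set C) (m n : nat) (a : C).
Local Notation N := (m + n).+1.
Hypotheses (K0 : K !=set0) (cK : compact K) (a0 : a != 0).
Variable tau : 'I_N -> C.
Hypotheses (tauP : chebyshev_nodes K tau) (tauT : forall j, Theta (tau j)).
Variables (K1 s0 M : R).
Hypotheses (K10 : 0 < K1) (s00 : 0 < s0) (M1 : 1 <= M).
Hypothesis local : forall (w : 'I_N -> C) (s : R), s <= s0 -> (forall j, cabs (w j) <= s) ->
    (exists r, newton_pade E f m n w r) /\
    (forall r, newton_pade E f m n w r -> forall z, cabs z <= s ->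
      ~~ rf_pole r z /\
      cabs (rf_eval r z - f z - a * \prod_j (z - w j))
        <= K1 * s * cabs (\prod_j (z - w j))).
Hypotheses (KM : forall z, K z -> cabs z <= M) (TM : forall z, Theta z -> cabs z <= M).

Let M0 : 0 < M.
Proof.
exact: lt_le_trans M1.
Qed.

Definition err_const : R := K1 * M * (2 * M) ^+ N.

Lemma err_const_gt0 : 0 < err_const.
Proof. by rewrite /err_const !mulr_gt0// exprn_gt0// mulr_gt0. Qed.

Lemma scaled_error (e : R) (zeta : 'I_N -> C) r : 0 < e -> e * M <= s0 ->
  (forall j, Theta (zeta j)) -> newton_pade E f m n (fun j => toC e * zeta j) r ->
  forall z, K z -> ~~ rf_pole r (toC e * z) /\
    cabs (rf_eval r (toC e * z) - f (toC e * z)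
      - a * toC e ^+ N * \prod_j (z - zeta j)) <= err_const * e ^+ N.+1.
Proof.
move=> e0 eM zT hr z Kz.
have sc u : cabs u <= M -> cabs (toC e * u) <= e * M.
  by move=> uM; rewrite cabsM cabs_toC gtr0_norm// ler_pM2l.
have [_ H] := local (fun j => toC e * zeta j) (e * M) eM (fun j => sc _ (TM _ (zT j))).
have [np err] := H r hr (toC e * z) (sc _ (KM _ Kz)); split => //.
move: err; rewrite prod_scale mulrA => /le_trans; apply.
rewrite cabsM cabsX cabs_toC (gtr0_norm e0).
have P : cabs (\prod_j (z - zeta j)) <= (2 * M) ^+ N.
  rewrite cabs_prod -[X in _ ^+ X]size_index_ord; apply: prod_le_expn => j; rewrite cabs_ge0/=.
  rewrite (le_trans (cabsB _ _))// mulr_natl mulr2n.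
  by apply: lerD; [exact: KM|apply: TM; exact: zT].
have -> : err_const * e ^+ N.+1 = K1 * (e * M) * (e ^+ N * (2 * M) ^+ N).
  by rewrite /err_const [e ^+ N.+1]exprS; ring.
apply: ler_wpM2l.
  by apply: mulr_ge0; [exact: ltW|apply: mulr_ge0; exact: ltW].
by apply: ler_wpM2l P; apply: exprn_ge0; exact: ltW.
Qed.

Lemma scaled_err_norm (e : R) (zeta : 'I_N -> C) r : 0 < e -> e * M <= s0 ->
  (forall j, Theta (zeta j)) -> newton_pade E f m n (fun j => toC e * zeta j) r ->
  err_norm (dilate e K) r f \is a fin_num /\
  `|fine (err_norm (dilate e K) r f) - cabs a * e ^+ N * node_max K zeta|
    <= err_const * e ^+ N.+1.
Proof.
move=> e0 eM zT hr; have H := scaled_error e zeta r e0 eM zT hr.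
have aeN : 0 < cabs a * e ^+ N by rewrite mulr_gt0 ?cabs_gt0// exprn_gt0.
have lead z : cabs (a * toC e ^+ N * \prod_j (z - zeta j)) =
    cabs a * e ^+ N * \prod_j cabs (z - zeta j).
  by rewrite !cabsM cabsX cabs_toC (gtr0_norm e0) cabs_prod.
have [|fin up lo] := err_norm_fin K e r f
  (cabs a * e ^+ N * node_max K zeta + err_const * e ^+ N.+1) K0.
  move=> z Kz; have [np err] := H z Kz; split => //.
  have := cabs_sub_ge (rf_eval r (toC e * z) - f (toC e * z))
    (a * toC e ^+ N * \prod_j (z - zeta j)); rewrite lead lerBlDl => /le_trans; apply.
  by rewrite lerD// ler_pM2l//; exact: le_node_max.
split=> //; rewrite ler_distl; apply/andP; split; last by rewrite addrC in up; rewrite addrC.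
rewrite lerBlDr mulrC -ler_pdivlMr//; apply: node_max_le => // z Kz.
rewrite ler_pdivlMr// mulrC -lead.
have [_ err] := H z Kz; rewrite cabsBC in err.
have := cabs_sub_ge (a * toC e ^+ N * \prod_j (z - zeta j))
  (rf_eval r (toC e * z) - f (toC e * z)).
rewrite lerBlDr => /le_trans; apply; rewrite addrC lerD//; exact: lo.
Qed.

(** A best approximation does at least as well as interpolation at the scaled
    Chebyshev nodes, and both error norms are |a| e ^ N times the node maximum up to
    O(e ^ (N + 1)); so its own nodes are optimal up to O(e). *)
Lemma best_scaled (e : R) (w : 'I_N -> C) r : 0 < e -> e * M <= s0 ->
  interp_best E f m n (dilate e Theta) (dilate e K) r ->
  (forall j, dilate e Theta (w j)) -> newton_pade E f m n w r ->
  [/\ forall j, Theta (w j / toC e),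
    w = (fun j => toC e * (w j / toC e)),
    node_max K (fun j => w j / toC e) <= node_max K tau + 2 * err_const / cabs a * e,
    err_norm (dilate e K) r f \is a fin_num &
    `|fine (err_norm (dilate e K) r f) - node_max K tau * cabs a * e ^+ N|
      <= err_const * e ^+ N.+1].
Proof.
move=> e0 eM [_ best] wT hr.
have te0 : toC e != 0 by rewrite toC_eq0 gt_eqF.
have zT j : Theta (w j / toC e).
  by have [u Tu <-] := wT j; rewrite mulrAC mulfV// mul1r.
have wE : w = (fun j => toC e * (w j / toC e)).
  by apply/funext => j; rewrite mulrCA mulfV// mulr1.
have a_gt0 : 0 < cabs a by rewrite cabs_gt0.
have aeN : 0 < cabs a * e ^+ N by rewrite mulr_gt0 ?exprn_gt0.
rewrite wE in hr.
have [fin bd] := scaled_err_norm e _ r e0 eM zT hr.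
have [|[rt hrt] _] := local (fun j => toC e * tau j) (e * M) eM.
  by move=> j; rewrite cabsM cabs_toC gtr0_norm// ler_pM2l//; apply: TM; exact: tauT.
have [fint bdt] := scaled_err_norm e tau rt e0 eM tauT hrt.
have le_t : fine (err_norm (dilate e K) r f) <= fine (err_norm (dilate e K) rt f).
  apply: fine_le => //; apply: best; exists (fun j => toC e * tau j) => //.
  by move=> j; exists (tau j).
have opt := tauP (fun j => w j / toC e).
have opt' : cabs a * e ^+ N * node_max K tau <=
    cabs a * e ^+ N * node_max K (fun j => w j / toC e) by rewrite ler_pM2l.
have EN : err_const * e ^+ N.+1 = cabs a * e ^+ N * (err_const / cabs a * e).
  by rewrite [e ^+ N.+1]exprSr; field; rewrite gt_eqF.
split=> //.
- rewrite -(ler_pM2l aeN) mulrDr.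
  have -> : cabs a * e ^+ N * (2 * err_const / cabs a * e) = 2 * (err_const * e ^+ N.+1).
    by rewrite EN; ring.
  move: bd bdt; rewrite !ler_distl => /andP[b1 _] /andP[_ b4].
  exact: squeeze_le b1 le_t b4.
- have -> : node_max K tau * cabs a * e ^+ N = cabs a * e ^+ N * node_max K tau by ring.
  move: bd bdt; rewrite !ler_distl => /andP[b1 _] /andP[_ b4].
  by rewrite (le_trans _ b1) ?lerD2r// (le_trans le_t).
Qed.

End Asymptotics.

(** * Asymptotics of interpolatory best approximations *)

Lemma near_optimal_nodes (R : realType) N (K Theta : set (Cplx R)) (tau : 'I_N -> Cplx R)
    (c : R) (zeta : R -> 'I_N -> Cplx R) :
  K !=set0 -> compact K -> isolated K = set0 -> chebyshev_nodes K tau ->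
  compact Theta -> 0 < c ->
  (\forall e \near 0^'+, (forall j, Theta (zeta e j)) /\
     node_max K (zeta e) <= node_max K tau + c * e) ->
  forall d : R, 0 < d -> \forall e \near 0^'+,
    exists s : {perm 'I_N}, forall j, cabs (zeta e (s j) - tau j) < d.
Proof.
move=> K0 cK isoK tauP cT c0 near d d0.
have [eta eta0 hd] := chebyshev_stable K N K0 cK tau Theta isoK tauP cT d d0.
have small : \forall e \near 0^'+, c * e <= eta.
  apply: (@near_right0 R _ (eta / c)); first by rewrite divr_gt0.
  by move=> e e0 ee; rewrite mulrC -ler_pdivlMr// ltW.
apply: filterS2 near small => e [zT zm] ce; apply: hd => //.
by rewrite (le_trans zm)// lerD2l.
Qed.

Theorem theorem8p1 (R : realType) (E : set (Cplx R)) (f : Cplx R -> Cplx R)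
    (K : set (Cplx R)) (m n : nat)
    (openE : open E) (connectedE : connected E) (E0 : E 0)
    (holf : holomorphic_on E f)
    (K0 : K !=set0) (compactK : compact K) (KE : K `<=` E)
    (isolK : isolated K = set0)
    (rP : ratfun R) (hrP : newton_pade E f m n (fun=> 0) rP)
    (nondeg : nondegenerate_rf m n rP)
    (a : Cplx R)
    (ha : (fun z => rf_eval rP z - f z - a * z ^+ (m + n).+1)
            =O_ (0 : Cplx R) (fun z => z ^+ (m + n).+2))
    (a_neq0 : a != 0)
    (tau : 'I_(m + n).+1 -> Cplx R) (htau : chebyshev_nodes K tau)
    (Theta : set (Cplx R)) (compactTheta : compact Theta)
    (ThetaE : Theta `<=` E) (tauTheta : forall j, Theta (tau j))
    (r : R -> ratfun R)
    (hr : \forall e \near 0^'+,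
      interp_best E f m n (dilate e Theta) (dilate e K) (r e)) :
  [/\ forall z : R -> 'I_(m + n).+1 -> Cplx R,
        (\forall e \near 0^'+,
           (forall j, dilate e Theta (z e j)) /\ newton_pade E f m n (z e) (r e)) ->
        exists s : R -> {perm 'I_(m + n).+1},
          forall j, z e (s e j) / toC e @[e --> 0^'+] --> tau j,
      forall eta : R, 0 < eta -> \forall e \near 0^'+, forall z, K z ->
        ~~ rf_pole (r e) (toC e * z) /\
        cabs (rf_eval (r e) (toC e * z) - f (toC e * z)
              - a * toC e ^+ (m + n).+1 * \prod_j (z - tau j))
          <= eta * e ^+ (m + n).+1
    & (\forall e \near 0^'+, err_norm (dilate e K) (r e) f \is a fin_num) /\
      (fun e => fine (err_norm (dilate e K) (r e) f)
                - node_max K tau * cabs a * e ^+ (m + n).+1)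
        =O_ (0^'+) (fun e => e ^+ (m + n).+2)].
Proof.
have [k0 k00 hak] : exists2 k : R, 0 < k & exists2 d : R, 0 < d & forall z, cabs z < d ->
    cabs (rf_eval rP z - f z - a * z ^+ (m + n).+1) <= k * cabs z ^+ (m + n).+2.
  have /eqO_exP[k k_gt0] := ha.
  have [k' k'0 kE] := lt_toC_exists k k_gt0.
  move=> /near_cabs[d d0 hd]; exists k' => //; exists d => // z zd.
  have := hd z; rewrite subr0 => /(_ zd) /=.
  by rewrite kE -cabsX -le_toC toCM !cabsE.
have [d0 d00 ha'] := hak.
have [K1 [s0 [K10 s00 local]]] :=
  newton_pade_local R E f m n rP a k0 d0 openE E0 holf hrP nondeg d00 ha'.
have [BK BK0 hBK] := compact_cabs_bounded K compactK.
have [BT BT0 hBT] := compact_cabs_bounded Theta compactTheta.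
pose M := 1 + BK + BT.
have M1 : 1 <= M by rewrite /M -addrA lerDl addr_ge0// ltW.
have M0 : 0 < M by rewrite (lt_le_trans _ M1).
have KM z : K z -> cabs z <= M.
  by move=> /hBK zB; rewrite (le_trans zB)// /M -addrA addrCA lerDl addr_ge0// ltW.
have TM z : Theta z -> cabs z <= M.
  by move=> /hBT zB; rewrite (le_trans zB)// /M lerDr addr_ge0// ltW.
pose Cst := err_const m n K1 M.
have Cst0 : 0 < Cst by exact: err_const_gt0.
have a_gt0 : 0 < cabs a by rewrite cabs_gt0.
have small : \forall e \near 0^'+, 0 < e /\ e * M <= s0.
  apply: (@near_right0 R _ (s0 / M)); first by rewrite divr_gt0.
  by move=> e e0 es; split => //; rewrite -ler_pdivlMr// ltW.
have best := best_scaled E f K Theta m n a K0 compactK a_neq0 tau htau tauTheta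
  K1 s0 M K10 M1 local KM TM.
have scaled := scaled_error E f K Theta m n a K1 s0 M K10 M1 local KM TM.
have c0 : 0 < 2 * Cst / cabs a by rewrite divr_gt0// mulr_gt0.
have nodes_close (w : R -> 'I_(m + n).+1 -> Cplx R) :
    (\forall e \near 0^'+, (forall j, dilate e Theta (w e j)) /\ newton_pade E f m n (w e) (r e)) ->
    forall d : R, 0 < d -> \forall e \near 0^'+,
      exists s : {perm 'I_(m + n).+1}, forall j, cabs (w e (s j) / toC e - tau j) < d.
  move=> hw; apply: (near_optimal_nodes R (m + n).+1 K Theta tau _ (fun e j => w e j / toC e)
    K0 compactK isolK htau compactTheta c0).
  apply: filterS3 hw hr small => e [wT we] be [e0 eM].
  by have [zT _ zm _ _] := best e (w e) (r e) e0 eM be wT we.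
have [w hw] : exists w : R -> 'I_(m + n).+1 -> Cplx R, \forall e \near 0^'+,
    (forall j, dilate e Theta (w e j)) /\ newton_pade E f m n (w e) (r e).
  have step (e : R) : exists w : 'I_(m + n).+1 -> Cplx R,
      interp_best E f m n (dilate e Theta) (dilate e K) (r e) ->
      (forall j, dilate e Theta (w j)) /\ newton_pade E f m n w (r e).
    have [[[w wT we] _]|nb] := pselect (interp_best E f m n (dilate e Theta) (dilate e K) (r e)).
      by exists w.
    by exists (fun=> 0).
  have [w wP] := boolp.choice step; exists w.
  by apply: filterS hr => e; exact: wP.
have FF : Filter (nbhs (0 : R)^'+) by typeclasses eauto.
have nearI (P Q : R -> Prop) : (\forall e \near 0^'+, P e) -> (\forall e \near 0^'+, Q e) ->
    \forall e \near 0^'+, P e /\ Q e by move=> hP hQ; exact: filterI.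
split.
- move=> z hz.
  pose dist e (s : {perm 'I_(m + n).+1}) : R := \sum_j cabs (z e (s j) / toC e - tau j).
  (* Closeness holds for some ordering at each tolerance; the ordering of least
     total distance serves all tolerances at once. *)
  exists (fun e => [arg min_(s < (1%g : {perm 'I_(m + n).+1})) dist e s]%O) => j.
  apply/cvg_cabs => eta eta0.
  have N0 : 0 < (m + n).+1%:R :> R by rewrite ltr0n.
  have d1 : 0 < eta / (m + n).+1%:R / 2 by rewrite !divr_gt0.
  apply: filterS (nodes_close z hz _ d1) => e [s hs].
  case: arg_minP => // s' _ /(_ s isT) le_s.
  apply: (@le_lt_trans _ _ (dist e s')).
    by rewrite /dist (bigD1 j)//= lerDl sumr_ge0// => i _; exact: cabs_ge0.
  rewrite (le_lt_trans le_s)//.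
  apply: (@le_lt_trans _ _ (\sum_(i < (m + n).+1) eta / (m + n).+1%:R / 2)).
    by apply: ler_sum => i _; exact: ltW.
  rewrite sumr_const card_ord -[ltLHS]mulr_natl.
  have -> : (m + n).+1%:R * (eta / (m + n).+1%:R / 2) = eta / 2.
    by field; rewrite gt_eqF.
  by rewrite ltr_pdivrMr// ltr_pMr// ltr1n.
- move=> eta eta0.
  pose B := 2 * M; have B1 : 1 <= B by rewrite /B mulr_natl mulr2n (le_trans M1)// lerDl ltW.
  (* Replacing the nodes by tau costs at most L d e ^ N, and d makes L d = eta / 2. *)
  pose L := cabs a * ((m + n).+1%:R * B ^+ (m + n).+1).
  have L0 : 0 < L.
    by rewrite /L mulr_gt0// mulr_gt0 ?ltr0n// exprn_gt0// (lt_le_trans ltr01).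
  pose d := eta / (2 * L); have d_gt0 : 0 < d by rewrite divr_gt0// mulr_gt0.
  have smallC : \forall e \near 0^'+, Cst * e <= eta / 2.
    apply: (@near_right0 R _ (eta / 2 / Cst)); first by rewrite !divr_gt0.
    by move=> e e0 ee; rewrite mulrC -ler_pdivlMr// ltW.
  have H := nearI _ _ (nearI _ _ hw hr) (nearI _ _ small smallC).
  apply: filterS (nearI _ _ H (nodes_close w hw d d_gt0)) => e
    [[[[wT we] be] [[e0 eM] Ce]] [s hs]] z Kz.
  have [zT wE _ _ _] := best e (w e) (r e) e0 eM be wT we.
  rewrite wE in we.
  have [np err] := scaled e _ (r e) e0 eM zT we z Kz; split => //.
  set zeta := fun j => w e j / toC e in zT err hs.
  have eN : 0 < e ^+ (m + n).+1 by rewrite exprn_gt0.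
  have pe : \prod_j (z - zeta j) = \prod_j (z - zeta (s j)).
    by rewrite (reindex_inj (@perm_inj _ s)).
  have pd : cabs (\prod_j (z - zeta j) - \prod_j (z - tau j)) <=
      (m + n).+1%:R * B ^+ (m + n).+1 * d.
    rewrite pe.
    have := @prod_dist R _ (index_enum 'I_(m + n).+1) (fun j => z - zeta (s j))
      (fun j => z - tau j) B d B1.
    have bB u : Theta u -> cabs (z - u) <= B.
      move=> Tu; rewrite (le_trans (cabsB _ _))// /B mulr_natl mulr2n.
      by apply: lerD; [exact: KM|exact: TM].
    rewrite size_index_ord; apply => j.
    + by apply: bB; exact: zT.
    + by apply: bB; exact: tauTheta.
    + have -> : z - zeta (s j) - (z - tau j) = - (zeta (s j) - tau j) by ring.
      by rewrite cabsN ltW// hs.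
  set X := rf_eval _ _ - f _ in err *.
  have -> : X - a * toC e ^+ (m + n).+1 * \prod_j (z - tau j) =
    (X - a * toC e ^+ (m + n).+1 * \prod_j (z - zeta j)) +
    a * toC e ^+ (m + n).+1 * (\prod_j (z - zeta j) - \prod_j (z - tau j)) by ring.
  have -> : eta * e ^+ (m + n).+1 = eta / 2 * e ^+ (m + n).+1 + eta / 2 * e ^+ (m + n).+1.
    by field.
  rewrite (le_trans (cabsD _ _))// lerD//.
    rewrite (le_trans err)// [e ^+ (m + n).+2]exprS mulrA ler_pM2r//.
  rewrite !cabsM cabsX cabs_toC (gtr0_norm e0) mulrAC ler_pM2r//.
  have -> : eta / 2 = cabs a * ((m + n).+1%:R * B ^+ (m + n).+1 * d).
    rewrite mulrA -/L /d; field; rewrite gt_eqF//.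
  by rewrite ler_pM2l.
have H := nearI _ _ hw (nearI _ _ hr small).
split.
  apply: filterS H => e [[wT we] [be [e0 eM]]].
  by have [] := best e (w e) (r e) e0 eM be wT we.
apply/eqO_exP; exists Cst => //.
apply: filterS H => e [[wT we] [be [e0 eM]]].
have [_ _ _ _ bd] := best e (w e) (r e) e0 eM be wT we.
by rewrite (le_trans bd)// ler_wpM2l ?ler_norm// ltW.
Qed.
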